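(* Let $\kappa$ be an infinite cardinal with successor cardinal $\kappa^+$, and let $X$ be any $(\ell_\infty(\kappa^+),\kappa)$-rigid octahedral real Banach space. Then $L(\ell_2(\kappa^+),X)_\kappa$ is $\kappa$-rigid octahedral but fails to be $\kappa^+$-octahedral.
   Context: $L(Y,X)$ is the space of bounded linear operators from $Y$ to $X$ with the operator norm. $\operatorname{dens}(E)$ is the least cardinality of a subset of $E$ whose linear span is dense in $E$ (so $\operatorname{dens}(E)=\dim E$ if $E$ is finite-dimensional). For an uncountable cardinal $\kappa$, $L(Y,X)_\kappa:=\{T\in L(Y,X):\operatorname{dens}(T(Y))<\kappa\}$, and $L(Y,X)_{\omega_0}:=\overline{F(Y,X)}$, the norm closure of the finite-rank bounded operators; both carry the operator norm. $\ell_2(\kappa^+)$ is the real Hilbert space of square-summable families indexed by $\kappa^+$. $S_E$ is the unit sphere of $E$. For an infinite cardinal $\lambda$, a normed space $E$ is $\lambda$-octahedral if for every cardinal $\lambda'<\lambda$, every collection $\{x_\gamma:\gamma<\lambda'\}\subseteq S_E$ and every $\varepsilon>0$ there exists $x\in S_E$ such that $\Vert x_\gamma+x\Vert\geq 2-\varepsilon$ for all $\gamma<\lambda'$. It is $\lambda$-rigid octahedral if for every such collection there is $x\in S_E$ with $\Vert x_\gamma+x\Vert=2$ for all $\gamma<\lambda'$. For a cardinal $\alpha'$, $\ell_\infty(\alpha')$ is the space of bounded real functions on a set of cardinality $\alpha'$ with the supremum norm. For infinite cardinals $\alpha,\beta$, a Banach space $X$ is $(\ell_\infty(\alpha),\beta)$-rigid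 octahedral if for every subset $Z\subseteq X$ with $|Z|<\beta$ and every cardinal $\alpha'<\alpha$ there exists a bounded linear operator $\phi:\ell_\infty(\alpha')\longrightarrow X$ with $\Vert\phi\Vert\leq1$ such that $\Vert z+\phi(y)\Vert=\Vert z\Vert+\Vert y\Vert$ for every $z\in Z$ and $y\in\ell_\infty(\alpha')$. *)

(* Defs.v *)
From HB Require Import structures.
From mathcomp Require Import all_boot all_order all_algebra.
From mathcomp Require Import all_classical all_reals all_analysis.
From mathcomp Require Import ring.

Set Implicit Arguments.
Unset Strict Implicit.
Unset Printing Implicit Defensive.

Import Order.TTheory GRing.Theory Num.Theory.
Import numFieldNormedType.Exports.

Local Open Scope classical_set_scope.
Local Open Scope ring_scope.
Local Open Scope card_scope.

(* Cardinals are represented by types (or sets), compared through injections;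
   "every cardinal l < L" becomes "every type I with [set: I] of cardinality
   strictly below that of [set: L]". *)

Definition card_lt (T U : Type) (A : set T) (B : set U) : Prop :=
  A #<= B /\ ~ (B #<= A).

Definition is_succ_card (K Kp : Type) : Prop :=
  card_lt [set: K] [set: Kp] /\
  forall T : Type, card_lt [set: K] [set: T] -> [set: Kp] #<= [set: T].

Section bounded_operators.
Variables (R : realType) (Y X : normedModType R).

Definition bounded_op : {pred Y -> X} := fun f =>
  `[< linear f /\ exists M : R, forall x, `|f x| <= M * `|x| >].

Record bop := Bop { bop_fun :> Y -> X ; bop_subproof : bop_fun \in bounded_op }.

HB.instance Definition _ := [isSub for bop_fun].
HB.instance Definition _ := [Choice of bop by <:].

Fact bounded_op_submod_closed : submod_closed bounded_op.
Proof.
split.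
  apply/asboolP; split; first by move=> a x y; rewrite scaler0 addr0.
  by exists 0 => x; rewrite normr0 mul0r.
move=> a f g /asboolP[lf [M hM]] /asboolP[lg [N hN]]; apply/asboolP; split.
  move=> b x y; rewrite /= !fctE lf lg !scalerDr !scalerA addrACA.
  by rewrite [a * b]mulrC.
exists (`|a| * M + N) => x; rewrite (le_trans (ler_normD _ _))//.
by rewrite mulrDl lerD// normrZ -mulrA ler_wpM2l.
Qed.
HB.instance Definition _ :=
  GRing.isSubmodClosed.Build R (Y -> X) bounded_op bounded_op_submod_closed.
HB.instance Definition _ := [SubChoice_isSubLmodule of bop by <:].

Lemma bop_linear (f : bop) : linear f.
Proof. by case/asboolP: (bop_subproof f). Qed.
HB.instance Definition _ (f : bop) :=
  GRing.isLinear.Build R Y X _ (f : Y -> X) (bop_linear f).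

Definition op_norm (f : bop) : R := sup [set `|f x| | x in [set x | `|x| <= 1]].

Lemma op_norm_ub (f : bop) :
  has_ubound [set `|f x| | x in [set x | `|x| <= 1]].
Proof.
have /asboolP[_ [M hM]] := bop_subproof f.
exists `|M| => _ [x /= x1 <-]; rewrite (le_trans (hM x))//.
by rewrite (le_trans (ler_norm _))// normrM normr_id ler_piMr.
Qed.

Lemma op_norm_le1 (f : bop) x : `|x| <= 1 -> `|f x| <= op_norm f.
Proof. by move=> x1; apply: (ub_le_sup (op_norm_ub f)); exists x. Qed.

Lemma op_norm_leP (f : bop) M :
  (forall x, `|x| <= 1 -> `|f x| <= M) -> op_norm f <= M.
Proof.
move=> h; apply: ge_sup; first by exists `|f 0|, 0 => //=; rewrite normr0.
by move=> _ [x x1 <-]; exact: h.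
Qed.

Lemma op_norm_le (f : bop) x : `|f x| <= op_norm f * `|x|.
Proof.
have [->|x0] := eqVneq x 0; first by rewrite linear0 !normr0 mulr0.
have nx0 : 0 < `|x| by rewrite normr_gt0.
rewrite -ler_pdivrMr// mulrC -{1}[X in X * _]ger0_norm ?invr_ge0//.
rewrite -normrZ -linearZ op_norm_le1// normrZ ger0_norm ?invr_ge0//.
by rewrite mulVf// gt_eqF.
Qed.

Lemma op_norm_ge0 (f : bop) : 0 <= op_norm f.
Proof. by rewrite (le_trans (normr_ge0 (f 0)))// op_norm_le1// normr0. Qed.

Lemma bopDE (f g : bop) x : (f + g) x = f x + g x. Proof. by []. Qed.
Lemma bopZE a (f : bop) x : (a *: f) x = a *: f x. Proof. by []. Qed.

Lemma op_normD (f g : bop) : op_norm (f + g) <= op_norm f + op_norm g.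
Proof.
apply: op_norm_leP => x x1; rewrite bopDE (le_trans (ler_normD _ _))//.
by rewrite lerD// op_norm_le1.
Qed.

Lemma op_normZ a (f : bop) : op_norm (a *: f) = `|a| * op_norm f.
Proof.
have h b (g : bop) : op_norm (b *: g) <= `|b| * op_norm g.
  by apply: op_norm_leP => x x1; rewrite bopZE normrZ ler_wpM2l// op_norm_le1.
apply/eqP; rewrite eq_le h /=; have [->|a0] := eqVneq a 0.
  by rewrite normr0 mul0r op_norm_ge0.
have a_gt0 : 0 < `|a| by rewrite normr_gt0.
rewrite mulrC -ler_pdivlMr// mulrC -normfV.
by rewrite -{1}[f]scale1r -(mulVf a0) -scalerA h.
Qed.

Lemma op_norm_eq0 (f : bop) : op_norm f = 0 -> f = 0.
Proof.
move=> f0; apply/val_inj/funext => x; apply/eqP; rewrite -normr_le0.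
by have := op_norm_le f x; rewrite f0 mul0r.
Qed.

HB.instance Definition _ :=
  Lmodule_isNormed.Build R bop op_normD op_normZ op_norm_eq0.

End bounded_operators.

Section linf.
Variables (R : realType) (I : Type).

Definition bounded_family : {pred I -> R} := fun f =>
  `[< exists M : R, forall i, `|f i| <= M >].

Record linf := Linf {
  linf_fun :> I -> R ; linf_subproof : linf_fun \in bounded_family }.

HB.instance Definition _ := [isSub for linf_fun].
HB.instance Definition _ := [Choice of linf by <:].

Fact bounded_family_submod_closed : submod_closed bounded_family.
Proof.
split; first by apply/asboolP; exists 0 => x; rewrite normr0.
move=> a f g /asboolP[M hM] /asboolP[N hN]; apply/asboolP.
exists (`|a| * M + N) => x; rewrite (le_trans (ler_normD _ _))//.
by rewrite lerD// normrM ler_wpM2l.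
Qed.
HB.instance Definition _ :=
  GRing.isSubmodClosed.Build R (I -> R) bounded_family
    bounded_family_submod_closed.
HB.instance Definition _ := [SubChoice_isSubLmodule of linf by <:].

Definition linf_norm (f : linf) : R := sup (range (fun i => `|f i|)).

Lemma linf_norm_ge (f : linf) i : `|f i| <= linf_norm f.
Proof.
have /asboolP[M hM] := linf_subproof f.
by apply: ub_le_sup; [exists M => _ [j _ <-]|exists i].
Qed.

Lemma linf_norm_leP (f : linf) M :
  0 <= M -> (forall i, `|f i| <= M) -> linf_norm f <= M.
Proof.
move=> M0 h; rewrite /linf_norm; set A := (X in sup X).
have [->|/set0P A0] := eqVneq A set0; first by rewrite sup0.
by apply: ge_sup => // _ [i _ <-].
Qed.

Lemma linf_norm_ge0 (f : linf) : 0 <= linf_norm f.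
Proof.
rewrite /linf_norm; set A := (X in sup X).
have [->|/set0P [_ [i _ _]]] := eqVneq A set0; first by rewrite sup0.
exact: le_trans (normr_ge0 _) (linf_norm_ge f i).
Qed.

Lemma linfDE (f g : linf) x : (f + g) x = f x + g x. Proof. by []. Qed.
Lemma linfZE a (f : linf) x : (a *: f) x = a * f x. Proof. by []. Qed.

Lemma linf_normD (f g : linf) : linf_norm (f + g) <= linf_norm f + linf_norm g.
Proof.
apply: linf_norm_leP => [|i]; first by rewrite addr_ge0 ?linf_norm_ge0.
by rewrite linfDE (le_trans (ler_normD _ _))// lerD ?linf_norm_ge.
Qed.

Lemma linf_normZ a (f : linf) : linf_norm (a *: f) = `|a| * linf_norm f.
Proof.
have h b (g : linf) : linf_norm (b *: g) <= `|b| * linf_norm g.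
  apply: linf_norm_leP => [|i]; first by rewrite mulr_ge0 ?linf_norm_ge0.
  by rewrite linfZE normrM ler_wpM2l ?linf_norm_ge.
apply/eqP; rewrite eq_le h /=; have [->|a0] := eqVneq a 0.
  by rewrite normr0 mul0r linf_norm_ge0.
have a_gt0 : 0 < `|a| by rewrite normr_gt0.
rewrite mulrC -ler_pdivlMr// mulrC -normfV.
by rewrite -{1}[f]scale1r -(mulVf a0) -scalerA h.
Qed.

Lemma linf_norm_eq0 (f : linf) : linf_norm f = 0 -> f = 0.
Proof.
move=> f0; apply/val_inj/funext => i; apply/eqP; rewrite -normr_le0.
by rewrite -f0 linf_norm_ge.
Qed.

HB.instance Definition _ :=
  Lmodule_isNormed.Build R linf linf_normD linf_normZ linf_norm_eq0.

End linf.

Section ell2.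
Variables (R : realType) (I : choiceType).

Definition sqsum (f : I -> R) : \bar R := (\esum_(i in [set: I]) (f i ^+ 2)%:E)%E.

Lemma sqsum_ge0 f : (0 <= sqsum f)%E.
Proof. by apply: esum_ge0 => i _; rewrite lee_fin sqr_ge0. Qed.

Lemma esumZ (c : R) (a : I -> R) : 0 <= c ->
  (\esum_(i in [set: I]) (c * a i)%:E = c%:E * \esum_(i in [set: I]) (a i)%:E)%E.
Proof.
move=> c0; rewrite /esum -ereal_supZl//; last first.
  by apply/set0P; exists 0%E, set0; rewrite ?fsbig_set0//; exact: fsets_set0.
congr ereal_sup; rewrite image_comp; apply: eq_imagel => A [finA _] /=.
rewrite !fsbig_finite//= !sumEFin -EFinM; congr EFin.
by rewrite mulr_sumr.
Qed.

Lemma sqsumZ c f : sqsum (c *: (f : I -> R)) = ((c ^+ 2)%:E * sqsum f)%E.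
Proof.
rewrite /sqsum -esumZ ?sqr_ge0//; apply: eq_esum => i _.
by rewrite /= exprMn.
Qed.

Lemma sqsum_term f i : ((f i ^+ 2)%:E <= sqsum f)%E.
Proof.
apply: esum_ge; exists [set i]; first by split.
by rewrite fsbig_set1.
Qed.

Lemma sqsumD (c : R) (f g : I -> R) : 0 < c ->
  (sqsum (f + g)%R <= (1 + c^-1)%:E * sqsum f + (1 + c)%:E * sqsum g)%E.
Proof.
move=> c0; have ci0 : 0 < c^-1 by rewrite invr_gt0.
have [h1 h2] : 0 <= 1 + c^-1 /\ 0 <= 1 + c by rewrite !addr_ge0// ltW.
rewrite /sqsum -!esumZ// -esumD; last 2 first.
- by move=> i _; rewrite lee_fin mulr_ge0 ?sqr_ge0.
- by move=> i _; rewrite lee_fin mulr_ge0 ?sqr_ge0.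
apply: le_esum => i _; rewrite -EFinD lee_fin fctE -subr_ge0.
rewrite (_ : _ - _ = c^-1 * (f i - c * g i) ^+ 2).
  by rewrite mulr_ge0 ?sqr_ge0// ltW.
by rewrite !sqrrD; field; rewrite gt_eqF.
Qed.

Definition sqsummable : {pred I -> R} := fun f => (sqsum f < +oo)%E.

Record ell2 := Ell2 { ell2_fun :> I -> R ; ell2_subproof : ell2_fun \in sqsummable }.

HB.instance Definition _ := [isSub for ell2_fun].
HB.instance Definition _ := [Choice of ell2 by <:].

Fact sqsummable_submod_closed : submod_closed sqsummable.
Proof.
split.
  by rewrite unfold_in /sqsum esum1// => i _; rewrite expr0n.
move=> a f g; rewrite !unfold_in => hf hg.
have := sqsumD (a *: f) g (@ltr01 R); move=> /le_lt_trans; apply.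
rewrite sqsumZ lte_add_pinfty//.
  by rewrite !lte_mul_pinfty// ?lee_fin ?sqr_ge0 ?mule_ge0 ?sqsum_ge0//.
by rewrite lte_mul_pinfty// lee_fin.
Qed.
HB.instance Definition _ :=
  GRing.isSubmodClosed.Build R (I -> R) sqsummable sqsummable_submod_closed.
HB.instance Definition _ := [SubChoice_isSubLmodule of ell2 by <:].

Definition ell2_norm (f : ell2) : R := Num.sqrt (fine (sqsum f)).

Lemma ell2_normK (f : ell2) : ((ell2_norm f ^+ 2)%:E = sqsum f)%E.
Proof.
rewrite sqr_sqrtr ?fine_ge0 ?sqsum_ge0// fineK//.
by rewrite ge0_fin_numE ?sqsum_ge0//; exact: (ell2_subproof f).
Qed.

Lemma ell2_norm_ge0 (f : ell2) : 0 <= ell2_norm f.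
Proof. exact: sqrtr_ge0. Qed.

Lemma ell2DE (f g : ell2) x : (f + g) x = f x + g x. Proof. by []. Qed.
Lemma ell2ZE a (f : ell2) x : (a *: f) x = a * f x. Proof. by []. Qed.

Lemma ell2_norm_eq0 (f : ell2) : ell2_norm f = 0 -> f = 0.
Proof.
move=> f0; apply/val_inj/funext => i; apply/eqP.
have := sqsum_term f i; rewrite -ell2_normK f0 expr0n lee_fin/=.
by rewrite le_eqVlt ltNge sqr_ge0 orbF sqrf_eq0.
Qed.

Lemma ell2_normZ a (f : ell2) : ell2_norm (a *: f) = `|a| * ell2_norm f.
Proof.
apply/eqP; rewrite -(@eqrXn2 _ 2) ?mulr_ge0 ?ell2_norm_ge0//.
rewrite -eqe ell2_normK exprMn EFinM ell2_normK real_normK ?num_real//.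
by rewrite -sqsumZ.
Qed.

Lemma ell2_normD (f g : ell2) : ell2_norm (f + g) <= ell2_norm f + ell2_norm g.
Proof.
have [/ell2_norm_eq0 ->|f0] := eqVneq (ell2_norm f) 0.
  by rewrite add0r lerDr ell2_norm_ge0.
have [/ell2_norm_eq0 ->|g0] := eqVneq (ell2_norm g) 0.
  by rewrite addr0 lerDl ell2_norm_ge0.
have {}f0 : 0 < ell2_norm f by rewrite lt_def f0 ell2_norm_ge0.
have {}g0 : 0 < ell2_norm g by rewrite lt_def g0 ell2_norm_ge0.
rewrite -(@ler_pXn2r _ 2) ?nnegrE ?addr_ge0 ?ell2_norm_ge0//.
rewrite -lee_fin ell2_normK.
have := @sqsumD (ell2_norm f / ell2_norm g) f g (divr_gt0 f0 g0).
rewrite -!ell2_normK -!EFinM -EFinD => /le_trans; apply.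
rewrite lee_fin le_eqVlt; apply/orP; left; apply/eqP.
by field; rewrite !gt_eqF.
Qed.

HB.instance Definition _ :=
  Lmodule_isNormed.Build R ell2 ell2_normD ell2_normZ ell2_norm_eq0.

End ell2.

Section density.
Variables (R : realType) (E : normedModType R).

Definition lspan (A : set E) : set E :=
  [set v | exists n (c : 'I_n -> R) (a : 'I_n -> E),
    (forall i, A (a i)) /\ v = \sum_(i < n) c i *: a i].

(* dens F < kappa for a linear subspace F: the least cardinality of a subset of
   F with dense linear span is < kappa iff some such subset has cardinality
   < kappa *)
Definition dens_lt (F : set E) (K : Type) : Prop :=
  exists A : set E,
    [/\ A `<=` F, F `<=` closure (lspan A) & card_lt A [set: K]].

(* The following notions are for a linear subspace F of E, viewed as a normed
   space with the norm of E. *)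

Definition octahedral (L : Type) (F : set E) : Prop :=
  forall I : Type, card_lt [set: I] [set: L] ->
  forall x : I -> E, (forall i, F (x i) /\ `|x i| = 1) ->
  forall e : R, 0 < e ->
  exists y : E, [/\ F y, `|y| = 1 & forall i, 2 - e <= `|x i + y|].

Definition rigid_octahedral (L : Type) (F : set E) : Prop :=
  forall I : Type, card_lt [set: I] [set: L] ->
  forall x : I -> E, (forall i, F (x i) /\ `|x i| = 1) ->
  exists y : E, [/\ F y, `|y| = 1 & forall i, `|x i + y| = 2].

End density.

Definition finite_rank (R : realType) (Y X : normedModType R) : set (bop Y X) :=
  [set T | exists A : set X, finite_set A /\ range T `<=` lspan A].

(* L(Y, X)_kappa for the infinite cardinal kappa = |K|; K countable means
   kappa = omega_0, where the norm closure of the finite-rank operators is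
   taken instead *)
Definition bop_small (R : realType) (Y X : normedModType R) (K : Type) :
    set (bop Y X) :=
  [set T | if `[< countable [set: K] >] then closure (@finite_rank R Y X) T
           else dens_lt (range T) K].

Definition linf_rigid_octahedral (alpha beta : Type) (R : realType)
    (X : completeNormedModType R) : Prop :=
  forall Z : set X, card_lt Z [set: beta] ->
  forall I : Type, card_lt [set: I] [set: alpha] ->
  exists phi : bop (linf R I) X,
    `|phi| <= 1 /\
    forall z, Z z -> forall y : linf R I, `|z + phi y| = `|z| + `|y|.

(* Main.v *)
Require Import Defs.
From mathcomp Require Import all_boot all_order all_algebra.
From mathcomp Require Import all_classical all_reals all_analysis.
From mathcomp Require Import ring lra.
Import numFieldNormedType.Exports.

(* Rigidity. Each [T i] in the family is normed by vectors of the Hilbert space: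
   almost, at countably many of them, in general; and exactly in the limit, along
   vectors [y] that are Cauchy by the parallelogram identity, if [T i] is compact
   (the case of a countable [K]).  Let [f j] be the inner products with (limits
   of) these vectors, and [S v = (f j v)_j] with values in l_infty(J).  The
   operator [W = phi \o S], where [phi] comes from rigid octahedrality of [X]
   applied to the set of all [T i y], satisfies |T i y + W y| = |T i y| + |S y|,
   which tends to 2.  Only the coordinates in the countable supports of the
   vectors matter for [S], so [W] has small range.

   Failure. For |x| = 1, consider the K many operators v |-> v_k x.  If [S] has
   norm 1 and |v |-> v_k x + S| is almost 2 for all k, then |S e_k| is almost 1
   for all k.  As the range of [S] has density < |K| (or [S] is compact), two
   vectors S e_k and S e_k' nearly coincide, and then |S (e_k + e_k')| is almost
   2, larger than |e_k + e_k'| = sqrt 2. *)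

Set Implicit Arguments.
Unset Strict Implicit.
Unset Printing Implicit Defensive.

Import Order.TTheory GRing.Theory Num.Theory.

Local Open Scope classical_set_scope.
Local Open Scope ring_scope.
Local Open Scope card_scope.

(** * Cardinal arithmetic *)

Lemma card_le_injP (T : Type) (U : pointedType) (A : set T) (B : set U) :
  A #<= B <-> exists h : T -> U, (forall x, A x -> B (h x)) /\
    (forall x y, A x -> A y -> h x = h y -> x = y).
Proof.
split=> [/pcard_leP/injfunPex[h hf hi]|[h [hf hi]]].
  by exists h; split=> // x y Ax Ay; apply: hi; rewrite inE.
apply/pcard_leP/injfunPex; exists h => // x y.
by rewrite !inE; exact: hi.
Qed.

Lemma card_leTP (T U : Type) :
  [set: T] #<= [set: U] <-> exists f : T -> U, injective f.
Proof.
split=> [/card_leP[f]|[f fi]]; last first.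
  apply: inj_card_le; apply: unsquash; apply/injfunPex.
  by exists f => // x y _ _; exact: fi.
pose i (x : T) : [set: T] := SigSub (mem_set (I : [set: T] x)).
exists (fun x => val (f (i x))) => x y /val_inj/(inj (f := f)) fxy.
by have := congr1 val (fxy (mem_set I) (mem_set I)).
Qed.

(** A partial injection that is maximal by Zorn is total or surjective, since a pair missed on both
    sides could be adjoined. The sets are first replaced by types. *)
Lemma card_le_total (T' U' : Type) (A : set T') (B : set U') :
  A #<= B \/ B #<= A.
Proof.
rewrite -!(card_le_eql (card_setT A), card_le_eqr (card_setT B)).
rewrite -!(card_le_eql (card_setT B), card_le_eqr (card_setT A)).
move: (A : Type) (B : Type) => T U.
pose P (G : set (T * U)) := forall p q, G p -> G q -> p.1 = q.1 <-> p.2 = q.2.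
have [|G [PG maxG]] := @Zorn_bigcup _ P.
  move=> F FP Ftot p q [C FC Cp] [D FD Dq].
  by have [CD|DC] := Ftot _ _ FC FD; [apply: (FP _ FD) => //; exact: CD
    |apply: (FP _ FC) => //; exact: DC].
have [domG|/existsNP[t0 t0P]] := pselect (forall t, exists u, G (t, u)).
  left; have [f fP] := choice domG; apply/card_leTP; exists f => x y fxy.
  exact/(PG _ _ (fP x) (fP y)).
have [codG|/existsNP[u0 u0P]] := pselect (forall u, exists t, G (t, u)).
  right; have [f fP] := choice codG; apply/card_leTP; exists f => x y fxy.
  exact/(PG _ _ (fP x) (fP y)).
have /maxG[] : G `<` (t0, u0) |` G.
  split=> [|GG]; first exact: subsetUr.
  by apply: t0P; exists u0; apply: GG; left.
move=> [t u] [t' u'] [[-> ->]|Gp] [[-> ->]|Gq] //=; last exact: (PG _ _ Gp Gq).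
- by split=> e; [case: t0P; exists u'; rewrite e|case: u0P; exists t'; rewrite e].
- by split=> e; [case: t0P; exists u; rewrite -e|case: u0P; exists t; rewrite -e].
Qed.

Section seq_card.
Variable I : pointedType.
Implicit Types (G : set (seq I * I)) (s t : seq I) (x y : I).

(* [G] is the graph of an injection into [B] of the nonempty sequences over
   [B], where [B] is the set of all [x] such that [[:: x]] is in its domain. *)
Let seq_dom G s := exists u, G (s, u).
Let seq_base G : set I := fun x => seq_dom G [:: x].
Let seq_all G s := forall x, x \in s -> seq_base G x.
Let seq_inj G := [/\ forall p q, G p -> G q -> p.1 = q.1 <-> p.2 = q.2,
  forall p, G p -> [/\ p.1 != [::], seq_all G p.1 & seq_base G p.2] &
  forall s, s != [::] -> seq_all G s -> seq_dom G s].

(** A finite sequence over the base of the union of a chain already lies over the base of one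
    member, by induction on its length, and the domain of that member contains it. *)
Let seq_inj_bigcup (F : set (set (seq I * I))) : F `<=` seq_inj ->
  total_on F subset -> seq_inj (\bigcup_(C in F) C).
Proof.
move=> FP Ftot; split.
- move=> p q [C FC Cp] [D FD Dq].
  by have [CD|DC] := Ftot _ _ FC FD; [case: (FP _ FD) => + _ _; apply => //; exact: CD
    |case: (FP _ FC) => + _ _; apply => //; exact: DC].
- move=> p [C FC Cp]; have [_ /(_ _ Cp)[p0 pall [u Cu]] _] := FP _ FC.
  split=> //; last by exists u, C.
  by move=> x /pall[v Cv]; exists v, C.
- case=> // x s _; elim: s x => [|y s IH] x xs.
    by have := xs x; rewrite inE eqxx; exact.
  have [|u [C FC Cu]] := IH y; first by move=> z zs; apply: xs; rewrite inE zs orbT.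
  have [|v [D FD Dv]] := xs x; first by rewrite inE eqxx.
  suff [E [FE Ey Ex]] : exists E, [/\ F E, seq_all E (y :: s) & seq_base E x].
    have [_ _ /(_ (x :: s))] := FP _ FE.
    have [_ _ /(_ [:: x, y & s])] := FP _ FE; case=> // [z|w Ew _].
      by rewrite inE => /orP[/eqP ->//|]; exact: Ey.
    by exists w, E.
  have [CD|DC] := Ftot _ _ FC FD; [exists D|exists C]; split=> //.
  + move=> z zs; have [_ /(_ _ Cu)[_ /(_ z zs)[w Cw] _] _] := FP _ FC.
    by exists w; exact: CD.
  + by exists v.
  + by have [_ /(_ _ Cu)[]] := FP _ FC.
  + by exists v; exact: DC.
Qed.

(* For a maximal such [G] with base [B], a copy of [B] in the complement of [B]
   could be adjoined to the base; hence the complement embeds into [B]. *)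
Lemma card_le_seq : infinite_set [set: I] -> [set: seq I] #<= [set: I].
Proof.
move=> /infiniteP/card_leTP[d dinj].
have [G [[Ginj Gdom Gall] maxG]] := Zorn_bigcup seq_inj_bigcup.
(* [g] turns the graph into a function, with the junk value [point] off the domain of [G]. *)
have [g gP] : exists g : seq I -> I, forall s u, G (s, u) -> g s = u.
  have /choice[g gP] : forall s, exists u, forall v, G (s, v) -> u = v.
    move=> s; have [[u Gu]|nGs] := pselect (seq_dom G s).
      by exists u => v Gv; apply/(Ginj _ _ Gu Gv).
    by exists point => v Gv; case: nGs; exists v.
  by exists g.
have gG s : s != [::] -> seq_all G s -> G (s, g s).
  by move=> s0 /(Gall _ s0)[u Gu]; rewrite (gP _ _ Gu).
have gB s : s != [::] -> seq_all G s -> seq_base G (g s).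
  by move=> s0 sG; have [_ _] := Gdom _ (gG _ s0 sG).
have ginj s t : s != [::] -> seq_all G s -> t != [::] -> seq_all G t ->
    g s = g t -> s = t.
  by move=> s0 sG t0 tG; have [_] := Ginj _ _ (gG _ s0 sG) (gG _ t0 tG).
(* An empty base means an empty [G], which would be properly extended by the sequences over the copy
   [d] of the naturals, numbered by [pickle]. *)
have [[b Bb]|nB] := pselect (exists b, seq_base G b); last first.
  exfalso; have GE : G = set0.
    by rewrite -subset0 => p Gp; have [_ _ Bp] := Gdom _ Gp; apply: nB; exists p.2.
  pose G' : set (seq I * I) := [set p | exists t : seq nat, [/\ t != [::],
    p.1 = map d t & p.2 = d (pickle t)]].
  have G'base x : seq_base G' x <-> exists n, x = d n.
    split=> [[u [t [_ /= xt _]]]|[n ->]].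
      by case: t xt => [|n [|//]] // [->]; exists n.
    by exists (d (pickle [:: n])), [:: n].
  apply: (maxG G'); first split; first by rewrite GE.
    move=> /(_ ([:: d 0%N], d (pickle [:: 0%N]))).
    by rewrite GE; apply; exists [:: 0%N].
  split.
  - move=> [s u] [s' u'] [t [t0 /= -> ->]] [t' [t'0 /= -> ->]].
    split=> [/(inj_map dinj) ->//|/dinj/(pcan_inj (@pickleK _)) -> //].
  - move=> [s u] [t [t0 /= -> ->]]; split.
    + by case: t t0.
    + by move=> x /mapP[n _ ->]; apply/G'base; exists n.
    + by apply/G'base; exists (pickle t).
  - move=> s s0 sG; have /choice[f fP] : forall x, exists n, x \in s -> x = d n.
      move=> x; case: (boolP (x \in s)) => [/sG/G'base[n xn]|]; last by exists 0%N.
      by exists n.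
    have sE : s = map d (map f s).
      by rewrite -map_comp -[LHS]map_id; apply/eq_in_map => x /fP.
    exists (d (pickle (map f s))), (map f s); split=> //.
    by case: s s0 {sG fP sE}.
suff [c [cB cinj]] : exists c : I -> I,
    (forall x, seq_base G (c x)) /\ injective c.
  (* The extra head [point] makes every sequence nonempty, so that injectivity of [g] applies. *)
  apply/card_leTP; exists (fun s => g (map c (point :: s))) => s t.
  have call u : seq_all G (map c u) by move=> x /mapP[y _ ->].
  move=> e; have := @ginj (map c (point :: s)) (map c (point :: t))
    isT (call _) isT (call _) e.
  by case=> /(inj_map cinj).
have gB1 x : seq_base G x -> seq_all G [:: x] by move=> Bx y; rewrite inE => /eqP ->.
have gB2 x : seq_base G x -> seq_all G [:: x; x].
  by move=> Bx y; rewrite !inE orbb => /eqP ->.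
have [/card_le_injP[h [hB hinj]]|/card_le_injP[h [hB hinj]]] :
    (~` seq_base G #<= seq_base G) \/ (seq_base G #<= ~` seq_base G).
  exact: card_le_total.
  (* Here the complement embeds into the base; elements of the two are told apart by the length of
     the sequence fed to [g]. *)
  pose c x := if pselect (seq_base G x) then g [:: x] else g [:: h x; h x].
  exists c; split=> [x|x y]; rewrite /c.
    by case: pselect => Bx; apply: gB => //; [exact: gB1|apply/gB2/hB].
  case: pselect => Bx; case: pselect => By; move=> /ginj e.
  - by have [] := e isT (gB1 _ Bx) isT (gB1 _ By).
  - by have [] := e isT (gB1 _ Bx) isT (gB2 _ (hB _ By)).
  - by have [] := e isT (gB2 _ (hB _ Bx)) isT (gB1 _ By).
  - by have [/(hinj _ _ Bx By)] := e isT (gB2 _ (hB _ Bx)) isT (gB2 _ (hB _ By)).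
exfalso.
(* In the other case the base is enlarged by its copy under [h]. Elements of [B'] are coded by
   sequences over the old base, of length one or two. *)
pose B' x := seq_base G x \/ exists2 y, seq_base G y & x = h y.
have [c [cP cinj]] : exists c : I -> seq I,
    (forall x, B' x -> c x != [::] /\ seq_all G (c x)) /\
    (forall x y, B' x -> B' y -> c x = c y -> x = y).
  have /choice[k kP] : forall x, exists y, B' x -> ~ seq_base G x ->
      seq_base G y /\ x = h y.
    move=> x; have [[z Bz xE]|nx] := pselect (exists2 z, seq_base G z & x = h z).
      by exists z.
    by exists point; case.
  exists (fun x => if pselect (seq_base G x) then [:: x] else [:: k x; k x]).
  split=> [x B'x|x y B'x B'y]; first by case: pselect => Bx; split=> //;
    [exact: gB1|apply: gB2; have [] := kP _ B'x Bx].
  case: pselect => Bx; case: pselect => By // [] // kxy.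
  by have [_ ->] := kP _ B'x Bx; have [_ ->] := kP _ B'y By; rewrite kxy.
(* [k] injects the nonempty sequences over [B'] into the old base: [g] is applied to the code of
   each entry, then to the resulting sequence. *)
pose k s := g (map (g \o c) s).
pose B'all s := forall x, x \in s -> B' x.
have kall s : B'all s -> seq_all G (map (g \o c) s).
  by move=> sB' x /mapP[y /sB'/cP[y0 yG] ->]; exact: gB.
have s0map s : s != [::] -> map (g \o c) s != [::] by case: s.
have kB s : s != [::] -> B'all s -> seq_base G (k s).
  by move=> s0 sB'; apply: gB; [exact: s0map|exact: kall].
have kinj s t : s != [::] -> B'all s -> t != [::] -> B'all t -> k s = k t -> s = t.
  move=> s0 sB' t0 tB'.
  move=> /ginj-/(_ (s0map _ s0) (kall _ sB') (s0map _ t0) (kall _ tB')).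
  elim: s t sB' tB' {s0 t0} => [|x s IH] [|y t]//= sB' tB' [gxy /IH ->]; last 2 first.
  - by move=> z zs; apply: sB'; rewrite inE zs orbT.
  - by move=> z zs; apply: tB'; rewrite inE zs orbT.
  have B'x : B' x by apply: sB'; rewrite mem_head.
  have B'y : B' y by apply: tB'; rewrite mem_head.
  have [[x0 xG] [y0 yG]] := (cP _ B'x, cP _ B'y).
  by congr cons; apply: cinj => //; exact: ginj.
(* A sequence with an entry outside the old base gets its value in the copy under [h], disjoint from
   the values of [G]; so [G'] is still injective. *)
pose D s := [/\ s != [::], B'all s & ~ seq_all G s].
pose G' := G `|` [set p | D p.1 /\ p.2 = h (k p.1)].
have B'b : B' (h b) by right; exists b.
have allB' s : seq_all G s -> B'all s by move=> sG x /sG; left.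
have G'base x : seq_base G' x <-> B' x.
  split=> [[u [/Gdom/= [_ + _]|[[/= _ + _] _]]]|B'x].
  - by move=> /(_ x); rewrite mem_head => /(_ isT); left.
  - by apply; rewrite mem_head.
  - have [Bx|nBx] := pselect (seq_base G x).
      by exists (g [:: x]); left; exact/gG/gB1.
    exists (h (k [:: x])); right; split=> //; split=> // [y|].
      by rewrite inE => /eqP ->.
    by move=> /(_ x); rewrite mem_head => /(_ isT).
have nDG p q : G p -> D q.1 -> q.2 = h (k q.1) -> p.1 <> q.1 /\ p.2 <> q.2.
  move=> Gp [q0 qB' nq] q2; have [_ pall Bp] := Gdom _ Gp; split=> [e|e].
    by apply: nq; rewrite -e.
  by have := hB _ (kB _ q0 qB'); rewrite -q2 -e; exact.
apply: (maxG G').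
  split; first exact: subsetUl.
  move=> G'G; have Gp : G ([:: h b], h (k [:: h b])).
    apply: G'G; right; split=> //; split=> //.
      by move=> y; rewrite inE => /eqP ->.
    by move=> /(_ (h b)); rewrite mem_head => /(_ isT); exact: hB.
  have [_ _] := Gdom _ Gp; apply: hB; apply: kB => //.
  by move=> y; rewrite inE => /eqP ->.
split.
- move=> p q [Gp|[Dp p2]] [Gq|[Dq q2]].
  + exact: Ginj.
  + by have [] := nDG _ _ Gp Dq q2.
  + by have [n1 n2] := nDG _ _ Gq Dp p2; split=> e; [case: n1|case: n2].
  + rewrite p2 q2; split=> [->//|].
    by case: Dp Dq => p0 pB' _ [q0 qB' _] /hinj/kinj; apply=> //; exact: kB.
- move=> p [Gp|[[p0 pB' _] p2]].
    have [p0 pG Bp] := Gdom _ Gp; split=> // [x /pG Bx|]; apply/G'base; by left.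
  split=> // [x /pB'|]; first by move=> ?; exact/G'base.
  by rewrite p2; apply/G'base; right; exists (k p.1) => //; exact: kB.
- move=> s s0 sG'.
  have [sG|nsG] := pselect (seq_all G s); first by exists (g s); left; exact: gG.
  by exists (h (k s)); right; split=> //; split=> // x /sG'/G'base.
Qed.

End seq_card.

Lemma card_le_seqs (T U : Type) :
  [set: T] #<= [set: U] -> [set: seq T] #<= [set: seq U].
Proof.
by move=> /card_leTP[f finj]; apply/card_leTP; exists (map f); exact: inj_map.
Qed.

(** The pair [(m, x)] becomes [m.+1] copies of [x]; the successor keeps [x] recoverable when [m] is
    0. *)
Lemma card_le_nat_seq (T : Type) : [set: nat * T] #<= [set: seq T].
Proof.
apply/card_leTP; exists (fun p => nseq p.1.+1 p.2) => -[m x] [n y] /= e.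
by case: (e) => ->; have := congr1 size e; rewrite /= !size_nseq => -[->].
Qed.

Lemma infinite_card_le_seq (T : Type) :
  infinite_set [set: T] -> [set: seq T] #<= [set: T].
Proof.
elim/Ppointed: T => T; last exact: card_le_seq.
by move=> h; case: h; rewrite emptyE.
Qed.

Lemma card_lt_le (T U V : Type) (A : set T) (B : set U) (C : set V) :
  A #<= B -> card_lt B C -> card_lt A C.
Proof.
move=> AB [BC nCB]; split; first exact: card_le_trans BC.
by move=> CA; apply: nCB; exact: card_le_trans AB.
Qed.

Lemma card_le_lt (T U V : Type) (A : set T) (B : set U) (C : set V) :
  card_lt A B -> B #<= C -> card_lt A C.
Proof.
move=> [AB nBA] BC; split; first exact: card_le_trans BC.
by move=> CA; apply: nBA; exact: card_le_trans CA.
Qed.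

Lemma finite_card_lt (T U : Type) (A : set T) (B : set U) :
  finite_set A -> infinite_set B -> card_lt A B.
Proof.
move=> finA infB; split; last by move=> /card_le_finite/(_ finA).
have /card_le_trans := finite_set_countable finA; apply.
exact/infiniteP.
Qed.

(** For finite [A] the sequences are countable, while [K] is not. For infinite [A] they inject into
    [seq (seq A)], and thus into [A]. *)
Lemma card_lt_seq_nat (T K : Type) (A : set T) : infinite_set [set: K] ->
  ~ countable [set: K] -> card_lt A [set: K] ->
  card_lt [set: seq (nat * A)] [set: K].
Proof.
move=> infK ncK AK; have [finA|infA] := pselect (finite_set A).
  have le1 : [set: seq (nat * A)] #<= [set: nat].
    have : [set: seq (nat * A)] #<= [set: seq (nat * nat)].
      apply: card_le_seqs; have /card_leTP[f fi] : [set: A] #<= [set: nat].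
        rewrite (card_le_eql (card_setT A)); exact: finite_set_countable.
      by apply/card_leTP; exists (fun p => (p.1, f p.2)) => -[m x] [n y] [-> /fi ->].
    by move=> /card_le_trans; apply; exact: countableP.
  apply: (card_lt_le le1); split; first exact/infiniteP.
  by move=> Kn; apply: ncK; exact: Kn.
have infA' : infinite_set [set: A].
  by rewrite (eq_finite_set (card_setT A)).
apply: card_lt_le AK; rewrite -(card_le_eqr (card_setT A)).
apply: card_le_trans (infinite_card_le_seq infA').
apply: (@card_le_trans _ (seq (seq A))); last first.
  exact/card_le_seqs/infinite_card_le_seq.
exact/card_le_seqs/card_le_nat_seq.
Qed.

Lemma card_lt_option (I K : Type) : infinite_set [set: K] ->
  card_lt [set: I] [set: K] -> card_lt [set: option I] [set: K].
Proof.
move=> infK IK; have [finI|infI] := pselect (finite_set [set: I]).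
  apply: finite_card_lt => //.
  rewrite (_ : [set: _] = [set None] `|` some @` [set: I]).
    by rewrite finite_setU; split; [exact: finite_set1|exact: finite_image].
  by apply/seteqP; split=> // -[i|] _; [right; exists i|left].
apply: card_lt_le IK; apply: card_le_trans (infinite_card_le_seq infI).
by apply/card_leTP; exists (fun o => if o is Some i then [:: i] else [::]) =>
  -[i|] [j|] // [->].
Qed.

Lemma countable_card_lt (T K : Type) (A : set T) :
  countable [set: K] -> card_lt A [set: K] -> finite_set A.
Proof.
move=> cK [_ nKA]; apply: contrapT => /infiniteP nA.
by apply: nKA; exact: card_le_trans nA.
Qed.

(** * Geometry of the Hilbert space *)

Section ell2_geometry.
Variables (R : realType) (I : choiceType).
Local Arguments ell2_fun : simpl never.
Implicit Types (x y z : ell2 R I) (c : I) (s t : seq (R * ell2 R I)).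

Lemma sqnormE x : ((`|x| ^+ 2)%:E = sqsum x)%E.
Proof. exact: ell2_normK. Qed.

Lemma ell2_coordD x y i : (x + y) i = x i + y i. Proof. by []. Qed.
Lemma ell2_coordZ a x i : (a *: x) i = a * x i. Proof. by []. Qed.
Lemma ell2_coordN x i : (- x) i = - x i. Proof. by []. Qed.

(** Nonnegative weights keep all terms nonnegative, so that sums over [I] are additive in the
    extended reals without summability conditions. *)
Lemma sqnorm_comb_esum s : all (fun p => 0 <= p.1) s ->
  ((\sum_(p <- s) p.1 * `|p.2| ^+ 2)%:E =
   \esum_(i in [set: I]) (\sum_(p <- s) p.1 * p.2 i ^+ 2)%:E)%E.
Proof.
elim: s => [_|p s IH /= /andP[p0 s0]].
  by rewrite big_nil esum1// => i _; rewrite big_nil.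
rewrite big_cons EFinD EFinM sqnormE -esumZ// IH// -esumD.
- by apply: eq_esum => i _; rewrite big_cons EFinD.
- by move=> i _; rewrite lee_fin mulr_ge0// sqr_ge0.
- move=> i _; rewrite lee_fin big_seq sumr_ge0// => q qs.
  by rewrite mulr_ge0 ?sqr_ge0//; exact: (allP s0).
Qed.

(* A linear identity between squares of coordinates, with nonnegative
   coefficients on each side, passes to the squares of the norms. *)
Lemma sqnorm_comb s t : all (fun p => 0 <= p.1) s -> all (fun p => 0 <= p.1) t ->
  (forall i, \sum_(p <- s) p.1 * p.2 i ^+ 2 = \sum_(p <- t) p.1 * p.2 i ^+ 2) ->
  \sum_(p <- s) p.1 * `|p.2| ^+ 2 = \sum_(p <- t) p.1 * `|p.2| ^+ 2.
Proof.
move=> s0 t0 st; apply: EFin_inj; rewrite !sqnorm_comb_esum//.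
by apply: eq_esum => i _; rewrite st.
Qed.

Lemma parallelogram x y :
  `|x + y| ^+ 2 + `|x - y| ^+ 2 = 2 * `|x| ^+ 2 + 2 * `|y| ^+ 2.
Proof.
have := @sqnorm_comb [:: (1, x + y); (1, x - y)] [:: (2, x); (2, y)].
rewrite !big_cons !big_nil /= !(mul1r, addr0); apply; rewrite ?ler01 ?ler0n//.
by move=> i; rewrite !big_cons !big_nil /= !(ell2_coordD, ell2_coordN); ring.
Qed.

(** The inner product, by polarization: its properties follow from [sqnorm_comb], and no series of
    products has to converge. *)
Definition ell2_ip x y : R := (`|x + y| ^+ 2 - `|x - y| ^+ 2) / 4.

Lemma ell2_ipDr x y z : ell2_ip x (y + z) = ell2_ip x y + ell2_ip x z.
Proof.
(* The cross terms cancel on each side, and all coefficients are nonnegative. *)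
have := @sqnorm_comb
  [:: (1, x + (y + z)); (1, x - y); (1, x - z)]
  [:: (1, x - (y + z)); (1, x + y); (1, x + z)].
rewrite !big_cons !big_nil /= !(mul1r, addr0) /ell2_ip ler01 => /(_ isT isT) h.
suff : `|x + (y + z)| ^+ 2 + (`|x - y| ^+ 2 + `|x - z| ^+ 2) =
    `|x - (y + z)| ^+ 2 + (`|x + y| ^+ 2 + `|x + z| ^+ 2) by lra.
apply: h => i; rewrite !big_cons !big_nil /= !(mul1r, addr0).
by rewrite !(ell2_coordD, ell2_coordN); ring.
Qed.

Lemma ell2_ipNr x y : ell2_ip x (- y) = - ell2_ip x y.
Proof. by rewrite /ell2_ip opprK -[in RHS]mulNr opprB. Qed.

Lemma ell2_ipZr a x y : ell2_ip x (a *: y) = a * ell2_ip x y.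
Proof.
(* [a] becomes a weight in [sqnorm_comb], hence must be nonnegative. *)
wlog a0 : a / 0 <= a.
  move=> h; have [/h //|/ltW a0] := leP 0 a.
  by apply: oppr_inj; rewrite -ell2_ipNr -scaleNr h ?oppr_ge0// mulNr.
have := @sqnorm_comb
  [:: (1, x + a *: y); (a, x - y)] [:: (1, x - a *: y); (a, x + y)].
rewrite !big_cons !big_nil /= !(mul1r, addr0) /ell2_ip ler01 a0 => /(_ isT isT) h.
suff : `|x + a *: y| ^+ 2 + a * `|x - y| ^+ 2 =
       `|x - a *: y| ^+ 2 + a * `|x + y| ^+ 2 by lra.
apply: h => i; rewrite !big_cons !big_nil /= !(mul1r, addr0).
by rewrite !(ell2_coordD, ell2_coordN, ell2_coordZ); ring.
Qed.

Lemma ell2_ipxx x : ell2_ip x x = `|x| ^+ 2.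
Proof.
rewrite /ell2_ip subrr normr0 expr0n subr0 -mulr2n -scaler_nat normrZ.
by rewrite ger0_norm// exprMn; field.
Qed.

Lemma ell2_ip_le1 x y : `|x| <= 1 -> `|y| <= 1 -> `|ell2_ip x y| <= 1.
Proof.
move=> x1 y1; have := parallelogram x y.
have {x1} : `|x| ^+ 2 <= 1 by rewrite expr_le1.
have {y1} : `|y| ^+ 2 <= 1 by rewrite expr_le1.
have := sqr_ge0 `|x + y|; have := sqr_ge0 `|x - y|.
by rewrite /ell2_ip ler_norml; move=> *; apply/andP; split; lra.
Qed.

Let unit_family c : I -> R := fun i => (i == c)%:R.

Lemma sqsum_unit_family c : sqsum (unit_family c) = 1%E.
Proof.
rewrite /sqsum (esumID [set c]); last by move=> i _; rewrite lee_fin sqr_ge0.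
rewrite setTI esum_set1; last by rewrite lee_fin sqr_ge0.
rewrite esum1 ?adde0 /unit_family ?eqxx ?expr1n// => i [_ /eqP/negbTE ->].
by rewrite expr0n.
Qed.

Fact unit_family_sqsummable c : unit_family c \in @sqsummable R I.
Proof. by rewrite unfold_in sqsum_unit_family ltry. Qed.

Definition unit_vec c : ell2 R I := Ell2 (unit_family_sqsummable c).

Lemma unit_vecE c i : unit_vec c i = (i == c)%:R. Proof. by []. Qed.

Lemma norm_unit_vec c : `|unit_vec c| = 1.
Proof.
apply/eqP; rewrite -(@eqrXn2 _ 2)// expr1n -eqe sqnormE.
by rewrite sqsum_unit_family.
Qed.

Lemma coord_le x c : `|x c| <= `|x|.
Proof.
rewrite -(@ler_pXn2r _ 2)// ?nnegrE// real_normK ?num_real//.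
by rewrite -lee_fin sqnormE sqsum_term.
Qed.

Lemma ell2_ip_unit_vec x c : x c = 0 -> ell2_ip x (unit_vec c) = 0.
Proof.
move=> xc; have := @sqnorm_comb [:: (1, x + unit_vec c)] [:: (1, x - unit_vec c)].
rewrite !big_cons !big_nil /= !(mul1r, addr0) /ell2_ip ler01 => /(_ isT isT) ->.
  by rewrite subrr mul0r.
move=> i; rewrite !big_cons !big_nil /= !(mul1r, addr0).
rewrite !(ell2_coordD, ell2_coordN) unit_vecE.
case: eqP => [->|_]; first by rewrite xc; ring.
by rewrite addr0 subr0.
Qed.

Lemma norm_unit_vecD c c' : c != c' -> `|unit_vec c + unit_vec c'| ^+ 2 = 2.
Proof.
move=> cc'; have := @sqnorm_comb [:: (1, unit_vec c + unit_vec c')]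
  [:: (1, unit_vec c); (1, unit_vec c')].
rewrite !big_cons !big_nil /= !(mul1r, addr0) !norm_unit_vec ler01 expr1n.
apply => // i; rewrite !big_cons !big_nil /= !(mul1r, addr0).
rewrite ell2_coordD !unit_vecE; case: eqP => [->|_]; last by rewrite expr0n/= !add0r.
by rewrite (negbTE cc') expr0n /= !addr0.
Qed.

Lemma norm_sub_coord x c :
  `|x - x c *: unit_vec c| ^+ 2 + x c ^+ 2 = `|x| ^+ 2.
Proof.
have := @sqnorm_comb [:: (1, x - x c *: unit_vec c); (x c ^+ 2, unit_vec c)]
  [:: (1, x)].
rewrite !big_cons !big_nil /= !(mul1r, addr0, mulr1) !norm_unit_vec ler01 expr1n.
rewrite sqr_ge0 mulr1; apply => // i; rewrite !big_cons !big_nil /= !(mul1r, addr0).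
rewrite !(ell2_coordD, ell2_coordN, ell2_coordZ) !unit_vecE.
by case: eqP => [->|_] /=; ring.
Qed.

Definition truncate (s : seq I) x : ell2 R I := \sum_(c <- s) x c *: unit_vec c.

Lemma truncateE (s : seq I) x i : uniq s -> truncate s x i = (i \in s)%:R * x i.
Proof.
rewrite /truncate; elim: s => [|c s IH] /=; first by rewrite big_nil mul0r.
move=> /andP[cs us]; rewrite big_cons ell2_coordD IH// ell2_coordZ unit_vecE inE.
case: eqP => [->|_]; first by rewrite (negbTE cs) mul0r addr0 mulrC.
by rewrite mulr0 add0r.
Qed.

(** A finite partial sum within [e ^+ 2] of [sqsum x] gives the support; by Pythagoras the squared
    norm of the remainder is at most what the partial sum lacks. *)
Lemma truncate_dense x (e : R) : 0 < e ->
  exists2 s : seq I, uniq s & `|x - truncate s x| < e.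
Proof.
move=> e0; have xfin : sqsum x \is a fin_num by rewrite -sqnormE.
have e20 : 0 < e ^+ 2 by rewrite exprn_gt0.
have [_ [F [finF _] <-]] := ub_ereal_sup_adherent e20 xfin.
rewrite fsbig_finite//= sumEFin.
change (ereal_sup _) with (sqsum x); rewrite -sqnormE -EFinB lte_fin.
set s : seq I := finmap.enum_fset (fset_set F) => Fx.
have us : uniq s by exact: finmap.fset_uniq.
exists s => //.
have := @sqnorm_comb [:: (1, x - truncate s x); (1, truncate s x)] [:: (1, x)].
rewrite !big_cons !big_nil /= !(mul1r, addr0) ler01 => /(_ isT isT) h.
have {}h : `|x - truncate s x| ^+ 2 + `|truncate s x| ^+ 2 = `|x| ^+ 2.
  apply: h => i; rewrite !big_cons !big_nil /= !(mul1r, addr0).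
  by rewrite !(ell2_coordD, ell2_coordN) truncateE//; case: (i \in s) => /=; ring.
have trF : \sum_(i <- s) x i ^+ 2 <= `|truncate s x| ^+ 2.
  rewrite -lee_fin sqnormE -sumEFin.
  apply: esum_ge; exists F; first by split.
  rewrite fsbig_finite//= !sumEFin lee_fin le_eqVlt; apply/orP; left; apply/eqP.
  by apply: eq_big_seq => i si; rewrite truncateE// si mul1r.
rewrite -(@ltr_pXn2r _ 2) ?nnegrE ?normr_ge0//; last exact: ltW.
have := lt_le_trans Fx trF; rewrite -h ltrBlDr addrC ltrD2l; exact.
Qed.

(** A truncation that omits [c] is at distance at least [|x c|] from [x]. Hence a [c] with
    [x c != 0] occurs in one of the finite supports of truncations with error below [1/(n+1)], which
    are enumerated by pairs. *)
Lemma countable_support c0 x :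
  exists f : nat -> I, forall c, x c != 0 -> exists n, f n = c.
Proof.
pose e n : R := n.+1%:R^-1.
have e0 n : 0 < e n by rewrite invr_gt0.
have /choice[s sP] n : exists s : seq I, uniq s /\ `|x - truncate s x| < e n.
  by have [s us xs] := truncate_dense x (e0 n); exists s.
pose nn n : nat * nat := odflt (0%N, 0%N) (unpickle n).
exists (fun n => nth c0 (s (nn n).1) (nn n).2).
move=> c xc; have [n cn] : exists n, c \in s n.
  apply: contrapT => /forallNP nc; have xc0 : 0 < `|x c| by rewrite normr_gt0.
  have [n nx] := ltr_add_invr xc0.
  have [us] := sP n; apply/negP; rewrite -leNgt; apply: le_trans (coord_le _ c).
  rewrite ell2_coordD ell2_coordN truncateE//.
  have /negP/negbTE -> := nc n; rewrite mul0r subr0.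
  by move: nx; rewrite add0r => /ltW.
by exists (pickle (n, index c (s n))); rewrite /nn pickleK /= nth_index.
Qed.

End ell2_geometry.

(** * Total boundedness of images under compact operators *)

Section finite_rank_nets.
Variables (R : realType) (X : normedModType R).
Implicit Types (s : seq X) (u v w : X).

(** The span of a list, by recursion so that [lin_net] can adjoin one generator at a time. *)
Fixpoint lin s : set X :=
  if s is a :: s' then [set v | exists c w, lin s' w /\ v = c *: a + w]
  else [set 0].

Lemma lin0 s : lin s 0.
Proof.
by elim: s => //= a s IH; exists 0, 0; split => //; rewrite scale0r addr0.
Qed.

Lemma linZD s c v w : lin s v -> lin s w -> lin s (c *: v + w).
Proof.
elim: s v w => [|a s IH] v w /=; first by move=> -> ->; rewrite scaler0 addr0.
move=> [d [v' [sv ->]]] [d' [w' [sw ->]]].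
exists (c * d + d'), (c *: v' + w'); split; first exact: IH.
by rewrite scalerDr scalerA addrACA -scalerDl.
Qed.

Lemma lin_mem s a : a \in s -> lin s a.
Proof.
elim: s => //= b s IH; rewrite inE => /orP[/eqP ->|/IH sa].
  by exists 1, 0; rewrite scale1r addr0; split => //; exact: lin0.
by exists 0, a; rewrite scale0r add0r.
Qed.

Lemma lspan_sub_lin (A : set X) s : A `<=` [set` s] -> lspan A `<=` lin s.
Proof.
move=> As _ [n [c [a [Aa ->]]]].
elim/big_rec: _ => [|i v _ sv]; first exact: lin0.
by apply: linZD => //; apply: lin_mem; exact: As.
Qed.

Lemma scalar_net (M e : R) : 0 < e ->
  exists C : seq R, forall c, `|c| <= M -> exists2 d, d \in C & `|c - d| < e.
Proof.
move=> e0; pose g j : R := - M + j%:R * e.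
exists [seq g j | j <- iota 0 (Num.truncn ((M + M) / e)).+1] => c.
rewrite ler_norml => /andP[Mc cM]; set j := Num.truncn ((c + M) / e).
have cMe : 0 <= (c + M) / e by rewrite divr_ge0 ?(ltW e0)//; lra.
exists (g j).
  apply/map_f; rewrite mem_iota /= add0n ltnS.
  by apply: Num.Theory.le_truncn; rewrite ler_pM2r ?invr_gt0// lerD2r.
have /andP[] := Num.Theory.truncn_itv cMe; rewrite -/j.
rewrite ler_pdivlMr// ltr_pdivrMr// => j1 j2.
rewrite /g ger0_norm; first by move: j2; rewrite -natr1; lra.
lra.
Qed.

(* In the inductive step, if [a] lies in the closure of the span of [s], then
   [lin (a :: s)] is approximated by [lin s]; otherwise the coefficient of [a]
   is bounded on the ball. *)
Lemma lin_net s (M e : R) : 0 < e -> exists N : seq X,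
  forall v, lin s v -> `|v| <= M -> exists2 w, w \in N & `|v - w| < e.
Proof.
elim: s M e => [|a s IH] M e e0.
  by exists [:: 0] => v -> _; exists 0; rewrite ?mem_head// subrr normr0.
have e20 : 0 < e / 2 by rewrite divr_gt0.
have [aclose|] := pselect (forall d : R, 0 < d -> exists2 w, lin s w & `|a - w| < d).
  have [N NP] := IH (M + e / 2) (e / 2) e20.
  exists N => _ [c [w [sw ->]]] cM.
  (* This tolerance for [a] becomes less than [e / 2] after multiplication by [c]; the summand 1
     avoids division by 0. *)
  have d0 : 0 < e / 2 / (`|c| + 1) by rewrite divr_gt0// ltr_wpDl.
  have [a' sa' aa'] := aclose _ d0.
  have cc : `|c *: a + w - (c *: a' + w)| < e / 2.
    rewrite opprD addrACA subrr addr0 -scalerBr normrZ.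
    have [->|c0] := eqVneq c 0; first by rewrite normr0 mul0r.
    have c0' : 0 < `|c| by rewrite normr_gt0.
    apply: (@lt_le_trans _ _ (`|c| * (e / 2 / (`|c| + 1)))).
      by rewrite ltr_pM2l.
    by rewrite mulrCA ler_piMr ?(ltW e20)// ler_pdivrMr ?ltr_wpDl// mul1r lerDl.
  have [|u uN vu] := NP (c *: a' + w) (linZD c sa' sw).
    rewrite -[X in `|X|](subrK (c *: a + w)) (le_trans (ler_normD _ _))//.
    by rewrite addrC lerD// distrC ltW.
  exists u => //; rewrite -[X in `|X|](subrKA (c *: a' + w)).
  by rewrite (le_lt_trans (ler_normD _ _))// [ltRHS](splitr e) ltrD.
move=> /existsNP[d /not_implyP[d0 afar]].
have {}afar w : lin s w -> d <= `|a - w|.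
  by move=> sw; rewrite leNgt; apply/negP => aw; apply: afar; exists w.
have eta0 : 0 < e / 2 / (`|a| + 1) by rewrite divr_gt0// ltr_wpDl.
have [C CP] := scalar_net (M / d) eta0.
have [N NP] := IH (M + M / d * `|a|) (e / 2) e20.
exists [seq x.1 *: a + x.2 | x <- [seq (c, w) | c <- C, w <- N]].
move=> _ [c [v [sv ->]]] cM.
(* For nonzero [c], the norm of [c *: a + v] is [|c|] times the distance from [a] to a vector of
   [lin s], which is at least [d]. *)
have cMd : `|c| <= M / d.
  rewrite ler_pdivlMr//; apply: le_trans cM.
  have [->|c0] := eqVneq c 0; first by rewrite normr0 mul0r.
  rewrite -[v](scalerKV c0) -scalerDr normrZ ler_wpM2l//.
  rewrite -[_ *: v]opprK; apply: afar; rewrite -scaleNr -[_ *: v]addr0.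
  by apply: linZD => //; exact: lin0.
have [c' c'C cc'] := CP _ cMd.
have [|w wN vw] := NP _ sv.
  rewrite -[v](addKr (c *: a)) addrC (le_trans (ler_normD _ _))// lerD//.
  by rewrite normrN normrZ ler_wpM2r.
exists (c' *: a + w).
  by apply/mapP; exists (c', w) => //; apply/allpairsP; exists (c', w).
rewrite opprD addrACA -scalerBl (le_lt_trans (ler_normD _ _))//.
rewrite [ltRHS](splitr e) ltrD// normrZ.
apply: (@le_lt_trans _ _ (`|c - c'| * (`|a| + 1))).
  by rewrite ler_wpM2l// lerDl.
by rewrite -ltr_pdivlMr// ltr_wpDl.
Qed.

Lemma bop_norm_le (Y : normedModType R) (T : bop Y X) y : `|T y| <= `|T| * `|y|.
Proof. exact: op_norm_le. Qed.

(** A finite-rank operator within [e / 2] of [T] maps the ball to a bounded part of a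
    finite-dimensional space, where [lin_net] applies. *)
Lemma finite_rank_closure_net (Y : normedModType R) (T : bop Y X) (e : R) :
  closure (@finite_rank R Y X) T -> 0 < e ->
  exists N : seq X, forall y, `|y| <= 1 -> exists2 w, w \in N & `|T y - w| < e.
Proof.
move=> clT e0; have e20 : 0 < e / 2 by rewrite divr_gt0.
have [T' [[A [finA TA]]]] := clT _ (nbhsx_ballx T _ e20).
rewrite -ball_normE /= => TT'.
have [s As] : exists s : seq X, A = [set` s] by exact/finite_seqP.
have [N NP] := lin_net s `|T'| e20.
exists N => y y1; have [||w wN Tw] := NP (T' y).
- by apply: (@lspan_sub_lin A); [rewrite As|apply: TA; exists y].
- by rewrite (le_trans (bop_norm_le _ _))// ler_piMr.
exists w => //; rewrite -[X in `|X|](subrKA (T' y)).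
rewrite (le_lt_trans (ler_normD _ _))// [ltRHS](splitr e) ltrD//.
apply: le_lt_trans TT'; have := bop_norm_le (T - T') y.
by move=> /le_trans; apply; rewrite ler_piMr.
Qed.

End finite_rank_nets.

(** * Norming functionals *)

Lemma ultra_fmap (T U : Type) (f : T -> U) (F : set_system T) :
  UltraFilter F -> UltraFilter (f @ F).
Proof.
move=> FU; split; first exact: fmap_proper_filter.
move=> G GF fFG; apply/seteqP; split=> A; last exact: fFG.
move=> GA; have [//|nFA] := in_ultra_setVsetC (f @^-1` A) FU.
have GnA : G (~` A) by apply: fFG; rewrite /nbhs/= /fmap preimage_setC.
by have /filter_ex[? []] : G (A `&` ~` A) by exact: filterI.
Qed.

Lemma ultra_has (T : Type) (V : eqType) (F : set_system T) (N : seq V)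
    (P : V -> set T) : UltraFilter F ->
  F [set x | exists2 w, w \in N & P w x] -> exists2 w, w \in N & F (P w).
Proof.
move=> FU; elim: N => [|w N IH] FN.
  by have /filter_ex[x [? ]] := FN.
have [Fw|nFw] := in_ultra_setVsetC (P w) FU; first by exists w; rewrite ?mem_head.
have [|u uN Fu] := IH; last by exists u => //; rewrite inE uN orbT.
apply: filterS (filterI FN nFw) => x [[u]].
by rewrite inE => /orP[/eqP -> //|uN Pu _]; exists u.
Qed.

Section norming_functional.
Variables (R : realType) (I : choiceType).

(** Kept as plain functions, since they also arise as pointwise limits along an ultrafilter. *)
Definition unit_functional (f : ell2 R I -> R) : Prop :=
  (forall a x y, f (a *: x + y) = a * f x + f y) /\
  forall x, `|x| <= 1 -> `|f x| <= 1.

Lemma ell2_ip_functional (x : ell2 R I) : `|x| <= 1 -> unit_functional (ell2_ip x).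
Proof.
move=> x1; split=> [a y z|y]; first by rewrite ell2_ipDr ell2_ipZr.
exact: ell2_ip_le1.
Qed.

Lemma unit_functional_le f x : unit_functional f -> `|f x| <= `|x|.
Proof.
move=> [flin f1]; have fZ a y : f (a *: y) = a * f y.
  have f0 : f 0 = 0 by have := flin (-1) 0 0; rewrite scaler0 addr0 mulN1r addNr.
  by rewrite -[a *: y]addr0 flin f0 addr0.
have [->|x0] := eqVneq x 0.
  by rewrite -(scale0r 0) fZ mul0r !normr0.
have nx0 : 0 < `|x| by rewrite normr_gt0.
have : `|f (`|x|^-1 *: x)| <= 1.
  by apply: f1; rewrite normrZ ger0_norm ?invr_ge0// mulVf// gt_eqF.
by rewrite fZ normrM ger0_norm ?invr_ge0// ler_pdivrMl// mulr1.
Qed.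

Lemma bop_almost_norming (Y X : normedModType R) (T : bop Y X) (e : R) :
  0 < e -> exists2 y, `|y| <= 1 & `|T| - e < `|T y|.
Proof.
move=> e0; apply: contrapT => h.
have : `|T| <= `|T| - e.
  apply: op_norm_leP => y y1; rewrite leNgt; apply/negP => Ty.
  by apply: h; exists y.
by rewrite lerBrDl gerDr leNgt e0.
Qed.

(* The vectors at which [T] nearly attains its norm form a Cauchy family up to
   passing to an ultrafilter: their images because [T] maps the ball to a
   totally bounded set, and they themselves by the parallelogram identity. *)
Lemma compact_norming (X : completeNormedModType R) (T : bop (ell2 R I) X) :
  `|T| = 1 ->
  (forall e : R, 0 < e -> exists N : seq X, forall y, `|y| <= 1 ->
     exists2 w, w \in N & `|T y - w| < e) ->
  exists z (f : ell2 R I -> R), [/\ `|z| = 1, unit_functional f &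
    forall e : R, 0 < e -> exists y, [/\ `|y| <= 1, `|T y - z| < e & 1 - e < f y]].
Proof.
move=> T1 Tnet.
pose B (d : R) : set (ell2 R I) := [set y | `|y| <= 1 /\ 1 - d < `|T y|].
have FF : ProperFilter (filter_from [set d : R | 0 < d] B).
  apply: filter_from_proper.
    apply: filter_from_filter; first by exists 1; exact: ltr01.
    move=> d d' d0 d'0; exists (Num.min d d'); first by rewrite /= lt_min d0.
    move=> y [y1 Ty]; split; split=> //; apply: le_lt_trans Ty;
      by rewrite lerD2l lerN2 ge_min lexx ?orbT.
  move=> d d0; have [y y1 Ty] := bop_almost_norming T d0.
  by exists y; split=> //; rewrite -T1.
have [U [UU FU]] := ultraFilterLemma FF.
have UB d : 0 < d -> U (B d) by move=> d0; apply: FU; exists d.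
have Uball : U [set y | `|y| <= 1] by apply: filterS (UB 1 ltr01) => y [].
have Unet e : 0 < e -> exists w, U [set y | `|T y - w| < e].
  move=> e0; have [N NP] := Tnet _ e0.
  have [|w _ Uw] := @ultra_has _ _ U N (fun w => [set y | `|T y - w| < e]) UU.
    by apply: filterS Uball => y; exact: NP.
  by exists w.
(* [U] contains sets with arbitrarily small image, so [T] is Cauchy along [U], and [X] is
   complete. *)
have /cvg_ex[z Tz] : cvg (T @ U).
  apply: cauchy_cvg; apply: cauchy_exP => e e0.
  have [w Uw] := Unet _ e0; exists w.
  rewrite /nbhs /= /fmap -ball_normE; apply: filterS Uw => y /=.
  by rewrite distrC.
have Uz e : 0 < e -> U [set y | `|T y - z| < e].
  move=> e0; have /cvgrPdist_lt/(_ _ e0) := Tz.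
  by apply: filterS => y; rewrite distrC.
(* For vectors of the ball the inner products with [v] stay in a compact segment, so they converge
   along [U]; the limits define [f]. *)
have f_ex v : exists L : R, `|L| <= `|v| /\ ell2_ip y v @[y --> U] --> L.
  have UUv : UltraFilter (fmap (fun y => ell2_ip y v) U) by exact: ultra_fmap.
  have := @segment_compact R (- `|v|) `|v|; rewrite compact_ultra.
  have Uv : U [set y | `|ell2_ip y v| <= `|v|].
    apply: filterS Uball => y y1.
    exact: (unit_functional_le v (ell2_ip_functional y1)).
  move=> /(_ _ UUv)[|L [/= Lv UL]].
    by rewrite /fmap /=; apply: filterS Uv => y /=; rewrite in_itv /= -ler_norml.
  by exists L; split=> //; move: Lv; rewrite in_itv /= -ler_norml.
have /choice[f fP] := f_ex.
(* Two almost norming vectors with images near [w] have [|y + y'|] near 2, so by the parallelogram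
   identity their inner product is near 1. *)
have ipT e : 0 < e -> exists A : set (ell2 R I),
    [/\ U A, A `<=` [set y | `|y| <= 1] &
    forall y y', A y -> A y' -> 1 - 12 * e <= ell2_ip y y'].
  move=> e0; have [w Uw] := Unet _ e0.
  exists (B e `&` [set y | `|T y - w| < e]); split.
  - by apply: filterI => //; exact: UB.
  - by move=> y [[]].
  move=> y y' [[y1 Ty] /= yw] [[y'1 Ty'] /= y'w].
  have w1 : 1 - 2 * e <= `|w|.
    have := ler_normD (T y - w) w; rewrite subrK; lra.
  have yy' : 2 - 6 * e <= `|y + y'|.
    have := bop_norm_le T (y + y'); rewrite T1 mul1r; apply: le_trans.
    have /(congr1 Num.norm) : (T y + T y') + ((w - T y) + (w - T y')) = 2 *: w.
      rewrite scaler_nat mulr2n addrACA; congr (_ + _);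
        by rewrite addrCA subrr addr0.
    rewrite -linearD normrZ ger0_norm// => wE.
    have := ler_normD (T (y + y')) ((w - T y) + (w - T y')); rewrite wE.
    have := ler_normD (w - T y) (w - T y').
    move: yw y'w; rewrite ![`|_ - w|]distrC; lra.
  (* If [2 - 6 * e < 0], the claimed bound lies below -1, and the inner product is at least -1 on
     the ball. *)
  have yy2 : (2 - 6 * e) ^+ 2 <= `|y + y'| ^+ 2 \/ 2 - 6 * e < 0.
    have [e6|] := leP 0 (2 - 6 * e); last by right.
    by left; rewrite ler_pXn2r ?nnegrE.
  have := parallelogram y y'.
  have y12 : `|y| ^+ 2 <= 1 by rewrite expr_le1.
  have y'12 : `|y'| ^+ 2 <= 1 by rewrite expr_le1.
  have := sqr_ge0 `|y + y'|; have := sqr_ge0 e.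
  by rewrite /ell2_ip; case: yy2; lra.
exists z, f; split.
- apply: (@cvg_unique _ _ (`|T y| @[y --> U])) => //; first exact: cvg_norm.
  apply/cvgrPdist_lt => e e0; apply: filterS (UB _ e0) => y [y1 Ty].
  have := bop_norm_le T y; rewrite T1 mul1r => Ty1.
  by rewrite ltr_norml; apply/andP; split; lra.
- split=> [a x y|x x1]; last by have [+ _] := fP x; move=> /le_trans; apply.
  apply: (@cvg_unique _ _ (ell2_ip u (a *: x + y) @[u --> U])) => //.
    by have [] := fP (a *: x + y).
  have -> : (fun u => ell2_ip u (a *: x + y)) =
      (fun u => a * ell2_ip u x + ell2_ip u y).
    by apply/funext => u; rewrite ell2_ipDr ell2_ipZr.
  have [[_ fx] [_ fy]] := (fP x, fP y).
  by apply: cvgD => //; exact: cvgMl_tmp.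
(* The divisor 13 exceeds the 12 of [ipT], which makes the bound on the limit [f y] strict. *)
move=> e e0; have e130 : 0 < e / 13 by rewrite divr_gt0.
have [A [UA A1 Aip]] := ipT _ e130.
have [y [Ay yz]] := filter_ex (filterI UA (Uz _ e0)).
exists y; split=> //; first exact: A1.
apply: (@lt_le_trans _ _ (1 - 12 * (e / 13))); first by lra.
have [_ fy] := fP y; apply: (cvgr_to_ge fy).
by apply: filterS UA => x Ax; exact: Aip.
Qed.

End norming_functional.

(** * Operators through bounded families *)

Section spans.
Variables (R : realType) (X : normedModType R).
Implicit Types (A : set X).

Lemma lspan0 A : lspan A 0.
Proof.
exists 0%N, (fun=> 0), (fun=> 0); split; first by case.
by rewrite big_ord0.
Qed.

Lemma lspan_cons A c a v : A a -> lspan A v -> lspan A (c *: a + v).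
Proof.
move=> Aa [n [d [b [Ab ->]]]].
exists n.+1, (fun i => oapp d c (unlift ord0 i)),
  (fun i => oapp b a (unlift ord0 i)).
split; first by move=> i; case: unliftP => [j _|_] /=.
rewrite big_ord_recl unlift_none /=; congr (_ + _).
by apply: eq_bigr => i _; rewrite liftK.
Qed.

Lemma lspan_sum A (T : Type) (s : seq T) (c : T -> R) (a : T -> X) :
  (forall i, a i != 0 -> A (a i)) -> lspan A (\sum_(i <- s) c i *: a i).
Proof.
move=> Aa; elim/big_rec: _ => [|i v _ Av]; first exact: lspan0.
have [->|/Aa Aai] := eqVneq (a i) 0; first by rewrite scaler0 add0r.
exact: lspan_cons.
Qed.

End spans.

Lemma bop_small_countable (R : realType) (Y X : normedModType R) (K : Type) :
  countable [set: K] -> @bop_small R Y X K = closure (@finite_rank R Y X).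
Proof. by move=> cK; apply/funext => T; rewrite /bop_small /= asboolT. Qed.

Lemma bop_small_uncountable (R : realType) (Y X : normedModType R) (K : Type) :
  ~ countable [set: K] -> @bop_small R Y X K = [set T | dens_lt (range T) K].
Proof. by move=> ncK; apply/funext => T; rewrite /bop_small /= asboolF. Qed.

Section operators.
Variables (R : realType).
Implicit Types (X Y : normedModType R).

Lemma bop_norm_leP X Y (T : bop Y X) (M : R) :
  (forall y, `|y| <= 1 -> `|T y| <= M) -> `|T| <= M.
Proof. exact: op_norm_leP. Qed.

Fact bop_comp_bounded X Y (Z : normedModType R) (T : bop Y X) (S : bop Z Y) :
  (T \o S) \in @bounded_op R Z X.
Proof.
apply/asboolP; split=> [a x y|]; first by rewrite /= !linearP.
exists (`|T| * `|S|) => x; rewrite /= (le_trans (bop_norm_le _ _))//.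
by rewrite -mulrA ler_wpM2l// bop_norm_le.
Qed.

Definition bop_comp X Y (Z : normedModType R) (T : bop Y X) (S : bop Z Y) :=
  Bop (bop_comp_bounded T S).

Variable I : choiceType.

Fact rank_one_bounded X (c : I) (x : X) :
  (fun v : ell2 R I => v c *: x) \in @bounded_op R (ell2 R I) X.
Proof.
apply/asboolP; split=> [a v w|].
  by rewrite ell2_coordD ell2_coordZ scalerDl scalerA.
by exists `|x| => v; rewrite normrZ mulrC ler_wpM2l// coord_le.
Qed.

Definition rank_one X (c : I) (x : X) := Bop (rank_one_bounded c x).

Lemma rank_oneE X (c : I) (x : X) v : rank_one c x v = v c *: x.
Proof. by []. Qed.

Lemma norm_rank_one X (c : I) (x : X) : `|x| = 1 -> `|rank_one c x| = 1.
Proof.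
move=> x1; apply/eqP; rewrite eq_le; apply/andP; split.
  apply: bop_norm_leP => v v1; rewrite rank_oneE normrZ x1 mulr1.
  exact: le_trans (coord_le _ _) v1.
have := bop_norm_le (rank_one c x) (unit_vec R c).
by rewrite norm_unit_vec mulr1 rank_oneE unit_vecE eqxx scale1r x1.
Qed.

Lemma rank_one_small X (K : Type) (c : I) (x : X) : infinite_set [set: K] ->
  bop_small K (rank_one c x).
Proof.
move=> infK; have rk v : lspan [set x] (rank_one c x v).
  by rewrite rank_oneE -[_ *: _]addr0; apply: lspan_cons => //; exact: lspan0.
have [cK|ncK] := pselect (countable [set: K]).
  rewrite bop_small_countable//; apply: subset_closure; exists [set x].
  split; first exact: finite_set1.
  by move=> _ [v _ <-].
rewrite bop_small_uncountable//; exists [set x]; split.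
- move=> _ ->; exists (unit_vec R c) => //.
  by rewrite rank_oneE unit_vecE eqxx scale1r.
- by move=> _ [v _ <-]; exact: subset_closure.
- exact: finite_card_lt (finite_set1 _) infK.
Qed.

Variable J : Type.

Section functionals.
Variable f : J -> ell2 R I -> R.
Hypothesis f1 : forall j, unit_functional (f j).

Fact functionals_bounded (v : ell2 R I) : f ^~ v \in @bounded_family R J.
Proof. by apply/asboolP; exists `|v| => j; exact: unit_functional_le. Qed.

Let functionals_fun v : linf R J := Linf (functionals_bounded v).

Fact functionals_bop : functionals_fun \in @bounded_op R (ell2 R I) (linf R J).
Proof.
apply/asboolP; split=> [a v w|].
  by apply/val_inj/funext => j /=; have [-> _] := f1 j.
exists 1 => v; rewrite mul1r; apply: linf_norm_leP => // j.
exact: unit_functional_le.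
Qed.

Definition functionals : bop (ell2 R I) (linf R J) := Bop functionals_bop.

Lemma functionals_le v : `|functionals v| <= `|v|.
Proof.
by apply: linf_norm_leP => // j; exact: unit_functional_le.
Qed.

Lemma functionals_ge v j : `|f j v| <= `|functionals v|.
Proof. exact: (linf_norm_ge (functionals v) j). Qed.

Lemma functionals_comp_le X (phi : bop (linf R J) X) :
  `|phi| <= 1 -> `|bop_comp phi functionals| <= 1.
Proof.
move=> phi1; apply: bop_norm_leP => v v1 /=.
rewrite (le_trans (bop_norm_le _ _))// mulr_ile1//.
exact: le_trans (functionals_le _) v1.
Qed.

(** [W] kills every unit vector outside the coordinates [g j n], so the images of truncations are
    spanned by the vectors [W (unit_vec R (g j n))]; truncations are dense and [W] is continuous. *)
Lemma functionals_comp_dens X (phi : bop (linf R J) X) (K : Type)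
    (g : J -> nat -> I) :
  card_lt [set: J * nat] [set: K] ->
  (forall j c, f j (unit_vec R c) != 0 -> exists n, g j n = c) ->
  dens_lt (range (bop_comp phi functionals)) K.
Proof.
set W := bop_comp _ _ => JK gP.
exists (range (fun p : J * nat => W (unit_vec R (g p.1 p.2)))); split.
- by move=> _ [p _ <-]; exists (unit_vec R (g p.1 p.2)).
- move=> _ [v _ <-] B /nbhs_ballP[e /= e0 eB].
  have W0 : 0 < `|W| + 1 by rewrite ltr_wpDl.
  have [s _ vs] := truncate_dense v (divr_gt0 e0 W0).
  exists (W (truncate s v)); split.
    rewrite /truncate linear_sum.
    under eq_bigr do rewrite linearZ.
    apply: lspan_sum => c Wc0.
    have [j [n <-]] : exists j n, g j n = c.
      apply: contrapT => /forallNP nj; move/eqP: Wc0; apply.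
      change (phi (functionals (unit_vec R c)) = 0).
      rewrite (_ : functionals _ = 0) ?linear0//.
      apply/val_inj/funext => j; apply: contrapT => /eqP fj0.
      by apply: (nj j); exact: gP.
    by exists (j, n).
  have Wv : `|W v - W (truncate s v)| <= `|W| * `|v - truncate s v|.
    by rewrite -linearB; exact: bop_norm_le.
  apply: eB; rewrite -ball_normE; apply: (le_lt_trans Wv).
  apply: (@le_lt_trans _ _ ((`|W| + 1) * `|v - truncate s v|)).
    by rewrite ler_wpM2r// lerDl.
  by rewrite mulrC -ltr_pdivlMr.
- by apply: card_lt_le JK; exact: card_image_le.
Qed.

End functionals.
End operators.

Section linf_indicator.
Variables (R : realType) (J : Type).

Let indicator_family (j : J) : J -> R := fun i => `[< i = j >]%:R.

Fact indicator_bounded j : indicator_family j \in @bounded_family R J.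
Proof.
by apply/asboolP; exists 1 => i; rewrite normr_nat lern1 leq_b1.
Qed.

Definition linf_indicator j : linf R J := Linf (indicator_bounded j).

Lemma linf_indicatorE j i : linf_indicator j i = `[< i = j >]%:R.
Proof. by []. Qed.

Lemma norm_linf_indicator j : `|linf_indicator j| = 1.
Proof.
apply/eqP; rewrite eq_le; apply/andP; split.
  apply: linf_norm_leP => // i.
  by rewrite linf_indicatorE normr_nat lern1 leq_b1.
have := linf_norm_ge (linf_indicator j) j.
by rewrite linf_indicatorE asboolT// normr1.
Qed.

End linf_indicator.

Lemma linf_finite_sum (R : realType) (J : Type) : finite_set [set: J] ->
  exists s : seq J,
    forall y : linf R J, y = \sum_(j <- s) y j *: linf_indicator R j.
Proof.
elim/Pchoice: J => J /finite_seqP[t tP].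
(* Without duplicates, each coordinate is counted once. *)
exists (undup t) => y; apply/val_inj/funext => i.
have ti : i \in undup t.
  by rewrite mem_undup; have : [set: J] i by []; rewrite tP.
have sumE (u : seq J) : val (\sum_(j <- u) y j *: linf_indicator R j) i =
    \sum_(j <- u) y j * `[< i = j >]%:R.
  elim: u => [|j u IH]; first by rewrite !big_nil.
  by rewrite !big_cons -IH.
rewrite sumE (big_rem _ ti) /= asboolT// mulr1 big_seq big1 ?addr0// => j.
rewrite (mem_rem_uniq _ (undup_uniq t)) inE => /andP[ji _].
by rewrite asboolF ?mulr0// => ij; rewrite ij eqxx in ji.
Qed.

Section rigid.
Variables (R : realType) (I : choiceType) (J : Type) (X : completeNormedModType R).
Variable f : J -> ell2 R I -> R.
Hypothesis f1 : forall j, unit_functional (f j).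

Lemma functionals_comp_finite_rank (phi : bop (linf R J) X) :
  finite_set [set: J] -> finite_rank (bop_comp phi (functionals f1)).
Proof.
move=> finJ; have [s sP] := linf_finite_sum R finJ.
exists (range (fun j => phi (linf_indicator R j))); split.
  exact: finite_image.
move=> _ [v _ <-].
have -> : bop_comp phi (functionals f1) v = phi (functionals f1 v) by [].
rewrite (sP (functionals f1 v)) linear_sum.
under eq_bigr do rewrite linearZ.
by apply: lspan_sum => j _; exists j.
Qed.

(* [phi] makes the values of the [T g] at almost norming vectors add up in norm
   with those of [phi \o functionals], which is almost normed there as well. *)
Lemma functionals_comp_rigid (Z : set X) (phi : bop (linf R J) X) (G : Type)
    (T : G -> bop (ell2 R I) X) :
  `|phi| <= 1 -> (forall z, Z z -> forall y, `|z + phi y| = `|z| + `|y|) ->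
  (forall g, `|T g| = 1) ->
  (forall g (e : R), 0 < e -> exists j z y,
    [/\ Z z /\ `|y| <= 1, `|T g y - z| < e, 1 - e < `|z| & 1 - e < f j y]) ->
  forall g, `|T g + bop_comp phi (functionals f1)| = 2.
Proof.
move=> phi1 Zphi T1 TP g; set W := bop_comp _ _.
apply/eqP; rewrite eq_le; apply/andP; split.
  rewrite (le_trans (ler_normD _ _))// T1.
  by have := functionals_comp_le f1 phi1; rewrite -/W; lra.
(* Three errors of [e / 3]: [|T g + W|] is at least [|z| + |functionals f1 y| - |T g y - z|]. *)
apply/ler_addgt0Pr => e e0; have e30 : 0 < e / 3 by rewrite divr_gt0.
have [j [z [y [[Zz y1] Tz z1 fy]]]] := TP g _ e30.
have := Zphi z Zz (functionals f1 y); have := functionals_ge f1 y j.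
have := ler_norm (f j y).
have := bop_norm_le (T g + W) y; rewrite -[(T g + W) y]/(T g y + W y).
have := ler_normD (T g y + W y) (z - T g y).
rewrite [T g y + W y]addrC -addrA subrKC [W y + z]addrC.
have : `|T g + W| * `|y| <= `|T g + W| by rewrite ler_piMr.
rewrite -[W y]/(phi (functionals f1 y)).
move: Tz; rewrite distrC; lra.
Qed.

End rigid.

Lemma card_lt_seq_countable (C : countType) (T K : Type) (A : set T) :
  infinite_set [set: K] -> ~ countable [set: K] -> card_lt A [set: K] ->
  card_lt [set: seq (C * A)] [set: K].
Proof.
move=> infK ncK AK; apply: card_lt_le (card_lt_seq_nat infK ncK AK).
apply: card_le_seqs; apply/card_leTP; exists (fun p => (pickle p.1, p.2)).
by move=> [c a] [c' a'] [/(pcan_inj pickleK) -> ->].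
Qed.

(** Rational coefficients make a dense part of the span indexed by [seq (rat * A)], whose
    cardinality stays below that of an uncountable [K] if that of [A] does. *)
Lemma rat_lspan_dense (R : realType) (X : normedModType R) (A : set X) (v : X)
    (e : R) :
  lspan A v -> 0 < e ->
  exists q : seq (rat * A), `|v - \sum_(p <- q) ratr p.1 *: val p.2| < e.
Proof.
move=> [n [c [a [Aa ->]]]]; elim: n c a Aa e => [|n IH] c a Aa e e0.
  by exists [::]; rewrite big_ord0 big_nil subrr normr0.
have e20 : 0 < e / 2 by rewrite divr_gt0.
have [q qP] := IH (c \o lift ord0) (a \o lift ord0) (fun i => Aa _) _ e20.
pose d := e / 2 / (`|a ord0| + 1).
have d0 : 0 < d by rewrite divr_gt0// ltr_wpDl.
have [r] : exists r, ratr r \in `]c ord0, (c ord0 + d)[.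
  by apply: rat_in_itvoo; rewrite ltrDl.
rewrite in_itv /= => /andP[cr rcd].
have cr_lt : `|c ord0 - ratr r| < d.
  by rewrite distrC ger0_norm ?subr_ge0 ?(ltW cr)// ltrBlDl.
exists ((r, SigSub (mem_set (Aa ord0)) : A) :: q).
rewrite big_ord_recl big_cons /= opprD addrACA -scalerBl.
rewrite (le_lt_trans (ler_normD _ _))// [ltRHS](splitr e) ltr_leD//; last exact: ltW.
rewrite normrZ; apply: (@le_lt_trans _ _ (`|c ord0 - ratr r| * (`|a ord0| + 1))).
  by rewrite ler_wpM2l// lerDl.
by rewrite -ltr_pdivlMr// ltr_wpDl.
Qed.

(** * The two halves of the proposition *)

Section proposition.
Variables (R : realType) (K : Type) (Kp : choiceType) (X : completeNormedModType R).
Hypotheses (hK : infinite_set [set: K]) (hKp : is_succ_card K Kp).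
Hypothesis hX : linf_rigid_octahedral Kp K X.

Let KKp : [set: K] #<= [set: Kp]. Proof. by case: hKp => -[]. Qed.

Let card_lt_Kp (T : Type) (A : set T) : card_lt A [set: K] -> card_lt A [set: Kp].
Proof. by move=> AK; exact: card_le_lt AK KKp. Qed.

(** For [Z] consisting of 0 only, [phi] is isometric; a one-point index set then gives a unit
    vector. *)
Lemma exists_unit : exists x : X, `|x| = 1.
Proof.
have unitK : card_lt [set: unit] [set: K].
  by apply: finite_card_lt => //; exact: finite_finset.
have [|phi [_ phiP]] := hX (Z := [set 0]) _ (card_lt_Kp unitK).
  by apply: finite_card_lt => //; exact: finite_set1.
exists (phi (linf_indicator R tt)).
have := phiP 0 erefl (linf_indicator R tt).
by rewrite add0r normr0 add0r norm_linf_indicator.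
Qed.

Lemma nonempty_Kp : inhabited Kp.
Proof.
have [f _] := (card_leTP K Kp).1 KKp.
by have [k _] := infinite_setN0 hK; exists; exact: f k.
Qed.

Let Y := ell2 R Kp.

(** As [K] is countable, [I] is finite, so one limit functional for each [T i] gives an operator [W]
    of finite rank. *)
Lemma small_rigid_countable (I : Type) (T : I -> bop Y X) :
  countable [set: K] -> card_lt [set: I] [set: K] ->
  (forall i, closure (@finite_rank R Y X) (T i) /\ `|T i| = 1) ->
  exists W : bop Y X, [/\ bop_small K W, `|W| <= 1 & forall i, `|T i + W| = 2].
Proof.
move=> cK IK TP; have finI := countable_card_lt cK IK.
have /choice[zf zfP] : forall i, exists zf : X * (Y -> R), [/\ `|zf.1| = 1,
    unit_functional zf.2 & forall e : R, 0 < e ->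
    exists y, [/\ `|y| <= 1, `|T i y - zf.1| < e & 1 - e < zf.2 y]].
  move=> i; have [clT T1] := TP i.
  have [|z [f zfP]] := compact_norming T1; last by exists (z, f).
  by move=> e; exact: finite_rank_closure_net.
have f1 i : unit_functional (zf i).2 by case: (zfP i).
have ZK : card_lt (range (fun i => (zf i).1)) [set: K].
  by apply: card_lt_le IK; exact: card_image_le.
have [phi [phi1 phiP]] := hX ZK (card_lt_Kp IK).
exists (bop_comp phi (functionals f1)); split.
- rewrite bop_small_countable//; apply: subset_closure.
  exact: functionals_comp_finite_rank.
- exact: functionals_comp_le.
- apply: functionals_comp_rigid phiP _ _ => // [i|i e e0]; first by case: (TP i).
  have [z1 _ /(_ _ e0)[y [y1 Ty fy]]] := zfP i.
  exists i, (zf i).1, y; split=> //; rewrite z1; lra.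
Qed.

(** The norm of [T i] may not be attained, so each [T i] gets a sequence of vectors that norm it up
    to [1/(n+1)]; the index set [I * nat] and the countable supports stay below the uncountable
    [K]. *)
Lemma small_rigid_uncountable (I : Type) (T : I -> bop Y X) :
  ~ countable [set: K] -> card_lt [set: I] [set: K] -> (forall i, `|T i| = 1) ->
  exists W : bop Y X, [/\ bop_small K W, `|W| <= 1 & forall i, `|T i + W| = 2].
Proof.
move=> ncK IK T1; have [c0] := nonempty_Kp.
have n0 n : 0 < n.+1%:R^-1 :> R by rewrite invr_gt0.
have /choice[y yP] : forall p : I * nat, exists y : Y,
    `|y| <= 1 /\ 1 - p.2.+1%:R^-1 < `|T p.1 y|.
  move=> [i n]; have [y y1 Ty] := bop_almost_norming (T i) (n0 n).
  by exists y; split=> //=; rewrite T1 in Ty.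
have y1 p : `|y p| <= 1 by case: (yP p).
have f1 p : unit_functional (ell2_ip (y p)) by exact: ell2_ip_functional.
have /choice[g gP] : forall p, exists g : nat -> Kp,
    forall c, y p c != 0 -> exists n, g n = c.
  by move=> p; exact: countable_support.
have JnK : card_lt [set: (I * nat) * nat] [set: K].
  have := card_lt_seq_nat hK ncK IK; apply: card_lt_le.
  apply/card_leTP.
  pose i (x : I) : [set: I] := SigSub (mem_set (Logic.I : [set: I] x)).
  exists (fun p => [:: (p.1.2, i p.1.1); (p.2, i p.1.1)]).
  by move=> [[a m] n] [[b m'] n'] [-> -> ->].
have JK : card_lt [set: I * nat] [set: K].
  apply: card_lt_le JnK; apply/card_leTP.
  by exists (fun p => (p, 0%N)) => p q [].
have ZK : card_lt (range (fun p => T p.1 (y p))) [set: K].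
  by apply: card_lt_le JK; exact: card_image_le.
have [phi [phi1 phiP]] := hX ZK (card_lt_Kp JK).
exists (bop_comp phi (functionals f1)); split.
- rewrite bop_small_uncountable//; apply: functionals_comp_dens JnK _ => p c.
  by move=> ipc; apply: gP; apply: contra_neq ipc; exact: ell2_ip_unit_vec.
- exact: functionals_comp_le.
- apply: functionals_comp_rigid phiP _ _ => // i e e0.
  have e20 : 0 < e / 2 by rewrite divr_gt0.
  have [n] := ltr_add_invr e20; rewrite add0r => ne.
  exists (i, n), (T i (y (i, n))), (y (i, n)).
  have [_ /= Ty] := yP (i, n); have := bop_norm_le (T i) (y (i, n)).
  rewrite T1 mul1r => Tyy.
  have {ne}Ty : 1 - e / 2 < `|T i (y (i, n))|.
    by apply: lt_trans Ty; rewrite ltrD2l ltrN2.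
  split.
  + by split=> //; exists (i, n).
  + by rewrite subrr normr0.
  + lra.
  (* Here [|y| >= |T i y| > 1 - e / 2], and [|y| ^+ 2 >= 2 * |y| - 1]. *)
  + rewrite ell2_ipxx; have := sqr_ge0 (1 - `|y (i, n)|); lra.
Qed.

Lemma small_rigid_octahedral : rigid_octahedral K (@bop_small R Y X K).
Proof.
move=> I IK T TP; have [[c] [x x1]] := (nonempty_Kp, exists_unit).
(* A rank-one operator of norm 1 is adjoined to the family: [|T' None + W| = 2] forces [|W| >= 1],
   also when [I] is empty. *)
pose T' o := if o is Some i then T i else rank_one c x.
have T'P o : bop_small K (T' o) /\ `|T' o| = 1.
  case: o => [i|] /=; first exact: TP.
  by split; [exact: rank_one_small|exact: norm_rank_one].
have [W [sW W1 T'W]] : exists W : bop Y X,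
    [/\ bop_small K W, `|W| <= 1 & forall o, `|T' o + W| = 2].
  have oK := card_lt_option hK IK.
  have [cK|ncK] := pselect (countable [set: K]).
    by apply: small_rigid_countable => // o; rewrite -(bop_small_countable _ _ cK).
  by apply: small_rigid_uncountable => // o; case: (T'P o).
exists W; split=> //; last by move=> i; exact: (T'W (Some i)).
apply/eqP; rewrite eq_le W1 /=.
have := ler_normD (T' None) W; rewrite T'W; have [_ ->] := T'P None; lra.
Qed.

Lemma pigeonhole_card (C : Type) (code : K -> C) :
  card_lt [set: C] [set: K] -> exists i j, i <> j /\ code i = code j.
Proof.
move=> [_ nKC]; apply: contrapT => inj; apply/nKC/card_leTP; exists code => i j ij.
by apply: contrapT => nij; apply: inj; exists i, j.
Qed.

Lemma small_image_close (k : K -> Kp) (S : bop Y X) : bop_small K S ->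
  exists i j, i <> j /\ `|S (unit_vec R (k i)) - S (unit_vec R (k j))| < 10^-1.
Proof.
move=> sS.
(* Fewer than [|K|] points approximate all images of unit vectors: a finite net if [K] is countable,
   rational combinations over [A] otherwise. Two indices share a point, and twice [1/20] is
   [1/10]. *)
suff [C [d [CK /choice[code codeP]]]] : exists (C : Type) (d : C -> X),
    card_lt [set: C] [set: K] /\
    forall i, exists c, `|S (unit_vec R (k i)) - d c| < 20^-1.
  have [i [j [ij cij]]] := pigeonhole_card code CK; exists i, j; split=> //.
  have := codeP i; have := codeP j; rewrite cij [in X in X -> _]distrC.
  have := ler_normD (d (code j) - S (unit_vec R (k j)))
    (S (unit_vec R (k i)) - d (code j)).
  rewrite [in X in X -> _]addrC subrKA; lra.
have e0 : 0 < 20^-1 :> R by rewrite invr_gt0.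
have e20 : 0 < 20^-1 / 2 :> R by rewrite divr_gt0.
have [cK|ncK] := pselect (countable [set: K]).
  move: sS; rewrite bop_small_countable// => sS.
  have [N NP] := finite_rank_closure_net sS e0.
  exists 'I_(size N), (fun m => nth 0 N m); split.
    by apply: finite_card_lt => //; exact: finite_finset.
  move=> i; have [|w wN Sw] := NP (unit_vec R (k i)); first by rewrite norm_unit_vec.
  have wN' : (index w N < size N)%N by rewrite index_mem.
  by exists (Ordinal wN'); rewrite /= nth_index.
move: sS; rewrite bop_small_uncountable// => -[A [_ SA AK]].
exists (seq (rat * A)), (fun q => \sum_(p <- q) ratr p.1 *: val p.2); split.
  exact: card_lt_seq_countable.
move=> i; have /SA/(_ _ (nbhsx_ballx _ _ e20)) : range S (S (unit_vec R (k i))).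
  by exists (unit_vec R (k i)).
move=> [v [Av]]; rewrite -ball_normE /= => Sv.
have [q vq] := rat_lspan_dense Av e20.
exists q; rewrite -[X in `|X|](subrKA v).
by rewrite (le_lt_trans (ler_normD _ _))// [ltRHS](splitr 20^-1) ltrD.
Qed.

Lemma small_not_octahedral : ~ octahedral Kp (@bop_small R Y X K).
Proof.
have /card_leTP[k kinj] := KKp; have [x x1] := exists_unit.
have KKp_lt : card_lt [set: K] [set: Kp] by case: hKp.
have e0 : 0 < 100%:R^-1 :> R by rewrite invr_gt0.
pose T i : bop Y X := rank_one (k i) x.
have TP i : bop_small K (T i) /\ `|T i| = 1.
  by split; [exact: rank_one_small|exact: norm_rank_one].
move=> /(_ K KKp_lt T TP _ e0)[S [sS S1 TS]].
(* From [|c| + |S y| > 198/100] both terms exceed [98/100]. Hence [|y - c *: u| <= 20/100], as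
   [1 - (98/100)^2 < (20/100)^2], and [|S u| >= 98/100 - 20/100]. *)
have Sk i : 78%:R / 100%:R <= `|S (unit_vec R (k i))|.
  have [y y1] := bop_almost_norming (T i + S) e0.
  rewrite -[(T i + S) y]/(T i y + S y) -[T i y]/(y (k i) *: x) => Ty.
  have := TS i; move: Ty; set c := y (k i); set u := unit_vec R (k i) => Ty TSi.
  have := ler_normD (c *: x) (S y); rewrite normrZ x1 mulr1 => cS.
  have Sy1 : `|S y| <= `|y| by have := bop_norm_le S y; rewrite S1 mul1r.
  have cy : `|c| <= `|y| by exact: coord_le.
  have := norm_sub_coord y (k i).
  rewrite -/c -/u -[c ^+ 2]real_normK ?num_real// => yc.
  have y21 : `|y| ^+ 2 <= 1 by rewrite expr_le1.
  have c98 : 98%:R / 100%:R <= `|c| by lra.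
  have c2 : (98%:R / 100%:R) ^+ 2 <= `|c| ^+ 2 by rewrite ler_pXn2r ?nnegrE//; lra.
  have yc2 : `|y - c *: u| <= 20%:R / 100%:R.
    rewrite -(@ler_pXn2r _ 2) ?nnegrE//; lra.
  have := bop_norm_le S (y - c *: u); rewrite S1 mul1r linearB linearZ => Syc.
  have := ler_normD (c *: S u) (S y - c *: S u); rewrite subrKC normrZ.
  have : `|c| * `|S u| <= `|S u| by rewrite ler_piMl//; lra.
  lra.
have [i [j [ij Sij]]] := small_image_close k sS.
have kij : k i != k j by apply/eqP => /kinj.
have := norm_unit_vecD R kij; set u := unit_vec R (k i) in Sij *.
set v := unit_vec R (k j) in Sij * => uv2.
(* [143/100] exceeds the square root of 2, while the images force [|S u + S v|] to be at least
   [2 * 78/100 - 1/10], that is [146/100]. *)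
have uv : `|u + v| < 143%:R / 100%:R.
  by rewrite -(@ltr_pXn2r _ 2) ?nnegrE// uv2; lra.
have := bop_norm_le S (u + v); rewrite S1 mul1r linearD.
have := ler_normD (S u + S v) (S u - S v).
rewrite addrACA subrr addr0 -mulr2n -scaler_nat normrZ normr_nat.
have := Sk i; rewrite -/u; lra.
Qed.

End proposition.

Theorem proposition7p1 (R : realType) (K : Type) (Kp : choiceType)
    (hK : infinite_set [set: K]) (hKp : is_succ_card K Kp)
    (X : completeNormedModType R) (hX : linf_rigid_octahedral Kp K X) :
  rigid_octahedral K (@bop_small R (ell2 R Kp) X K) /\
  ~ octahedral Kp (@bop_small R (ell2 R Kp) X K).
Proof.
by split; [exact: small_rigid_octahedral|exact: small_not_octahedral].
Qed.
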